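(* Let $f \in C((0,\infty);(0,\infty))$ be asymptotically increasing with $\lim_{x\to\infty} f(x)/x = \infty$, and let $w \in C([0,\infty);[0,\infty))$ with $w(0)>0$. Suppose \[ \int_\eta^\infty \frac{du}{\sqrt{\int_0^u f(s)\,ds}} < \infty \quad \text{for some } \eta>0, \] and that $f$ preserves superexponential growth. Then solutions of \[ x'(t) = \int_0^t w(t-s) f(x(s))\,ds, \quad t \ge 0; \qquad x(0)>0, \] blow up in finite time and satisfy \[ \lim_{t\to T^-} \frac{F_B(x(t))}{T-t} = \sqrt{2w(0)}, \] where $T$ is the blow-up time and $F_B(x) = \int_x^\infty \frac{du}{\sqrt{\int_0^u f(s)\,ds}}$ for $x>0$.
   Context: ''$f$ is asymptotically increasing'' means that there is a continuous increasing function $\phi:(0,\infty)\to(0,\infty)$ with $f(x)/\phi(x)\to 1$ as $x\to\infty$. A function $g \in C((0,\infty);(0,\infty))$ exhibits superexponential growth if $g(x)\to\infty$ as $x\to\infty$ and $\lim_{x\to\infty} g(x-\epsilon)/g(x) = 0$ for each $\epsilon>0$. A function $\phi \in C((0,\infty);(0,\infty))$ preserves superexponential growth if for every $g$ exhibiting superexponential growth and every $\epsilon>0$, $\lim_{x\to\infty}\phi(g(x-\epsilon))/\phi(g(x)) = 0$. A solution blows up in finite time if there is $T>0$ with $x \in C([0,T);[0,\infty))$ and $\lim_{t\to T^-}|x(t)|=\infty$; the minimal such $T$ is the blow-up time. *)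

(* Defs.v *)
From Stdlib Require Import Reals.
From Coquelicot Require Export Coquelicot.
Open Scope R_scope.

Definition asymp_increasing (f : R -> R) : Prop :=
  exists phi : R -> R,
    (forall x, 0 < x -> continuous phi x /\ 0 < phi x) /\
    (forall x y, 0 < x -> x < y -> phi x < phi y) /\
    filterlim (fun x => f x / phi x) (Rbar_locally p_infty) (locally 1).

Definition superexp_growth (g : R -> R) : Prop :=
  (forall x, 0 < x -> continuous g x /\ 0 < g x) /\
  filterlim g (Rbar_locally p_infty) (Rbar_locally p_infty) /\
  (forall eps, 0 < eps ->
     filterlim (fun x => g (x - eps) / g x) (Rbar_locally p_infty) (locally 0)).

Definition preserves_superexp (phi : R -> R) : Prop :=
  forall g : R -> R, superexp_growth g ->
  forall eps, 0 < eps ->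
    filterlim (fun x => phi (g (x - eps)) / phi (g x))
      (Rbar_locally p_infty) (locally 0).

Definition prim (f : R -> R) (u : R) : R :=
  RInt_gen f (at_right 0) (at_point u).

Definition F_B (f : R -> R) (x : R) : R :=
  RInt_gen (fun u => / sqrt (prim f u)) (at_point x) (Rbar_locally p_infty).

Definition is_solution (w f x : R -> R) (S : Rbar) : Prop :=
  Rbar_lt 0 S /\
  0 < x 0 /\
  (forall t, 0 <= t -> Rbar_lt t S -> 0 < x t) /\
  filterlim x (at_right 0) (locally (x 0)) /\
  (forall t, 0 < t -> Rbar_lt t S ->
     is_derive x t (RInt (fun s => w (t - s) * f (x s)) 0 t)).

Definition is_maximal_solution (w f x : R -> R) (S : Rbar) : Prop :=
  is_solution w f x S /\
  forall (y : R -> R) (S' : Rbar),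
    is_solution w f y S' -> Rbar_le S S' ->
    (forall t, 0 <= t -> Rbar_lt t S -> y t = x t) -> S' = S.

(* Main.v *)
(* With I(t) = int_0^t f(x(s)) ds, near a finite blow-up time T the mass of f(x) concentrates at T,
   so x' ~ w(0) I. Since I' = f(x), the derivatives f(x) x' of F(x) and w(0) I I' of w(0) I^2 / 2 are
   equivalent (F the primitive of f), hence F(x) ~ w(0) I^2 / 2 and x' / sqrt(F(x)) -> sqrt(2 w(0)).
   As -x' / sqrt(F(x)) is the derivative of F_B(x), which tends to 0, this gives the rate.

   A global solution grows superexponentially, and f preserves this, so f(x(t - d)) is negligible
   against f(x(t)) and x' >= const * I even though w need not be bounded below. Replacing f by an
   equivalent increasing function, x dominates a function z with z'' >= const * f(z), whose energy
   estimate makes F_B(z) decrease linearly, contradicting F_B >= 0.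

   A maximal solution with finite lifetime is unbounded because a bounded one can be continued: f is
   only continuous, so this is a Peano argument, with Tonelli's delayed approximations and an
   ultrafilter limit in place of the Arzela-Ascoli theorem. *)

Require Import Defs.
From Stdlib Require Import Reals Lra Classical ClassicalChoice.
From Coquelicot Require Import Coquelicot.
From mathcomp Require filter.
Open Scope R_scope.

(** Since [w] is only continuous, x' need not be differentiable, so [x] itself satisfies no
    second-order equation. This shapes both halves of the argument. The rate is obtained by
    comparing F(x) with I^2, for which the first derivatives x' and I' suffice. Against global
    solutions, the second-order inequality is given to an auxiliary double primitive built to be
    twice differentiable, and a monotone substitute for [f] turns the ordering of that function
    below [x] into an inequality in that function alone.

    As [w] and [f] take nonnegative values, [x] is nondecreasing. A bounded solution therefore has a
    limit at the end of its interval, which serves as the starting value of a continuation, and an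
    unbounded one tends to infinity as a whole.

    Maximality is contradicted by exhibiting a single extension, so any limit of the delayed
    approximations will do: neither uniqueness nor a convergent subsequence has to be produced. The
    continuation is carried out for a clamped, hence bounded, version of [f], and the clamp stays
    inactive for a short time past the old end point. *)

Lemma mean_value (h dh : R -> R) (a b : R) :
  a < b ->
  (forall t, a <= t <= b -> continuous h t) ->
  (forall t, a < t < b -> is_derive h t (dh t)) ->
  exists c, a < c < b /\ h b - h a = dh c * (b - a).
Proof.
intros Hab Hc Hd.
assert (pr1 : forall c, a < c < b -> derivable_pt h c).
{ intros c Hcab. exists (dh c). apply is_derive_Reals. now apply Hd. }
assert (pr2 : forall c, a < c < b -> derivable_pt id c).
{ intros c _. apply derivable_pt_id. }
destruct (MVT h id a b pr1 pr2 Hab) as [c [P E]].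
- intros c Hcab. apply continuity_pt_filterlim. now apply Hc.
- intros c _. apply derivable_continuous_pt, derivable_pt_id.
- exists c. split; [exact P|].
  rewrite (derive_pt_eq_0 _ _ (dh c) (pr1 c P)) in E.
  2:{ apply is_derive_Reals. now apply Hd. }
  rewrite (derive_pt_eq_0 _ _ 1 (pr2 c P)) in E.
  2:{ apply derivable_pt_lim_id. }
  unfold id in E. lra.
Qed.

(** The derivative is asked for on the open interval only, because the equation is posed for
    positive times while estimates often start at time 0. *)
Lemma le_of_derive_nonneg (h dh : R -> R) (a b : R) :
  a <= b ->
  (forall t, a <= t <= b -> continuous h t) ->
  (forall t, a < t < b -> is_derive h t (dh t)) ->
  (forall t, a < t < b -> 0 <= dh t) ->
  h a <= h b.
Proof.
intros [Hab| ->] Hc Hd Hp; [|apply Rle_refl].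
destruct (mean_value h dh a b Hab Hc Hd) as [c [Hcab E]].
assert (0 <= dh c * (b - a)).
{ apply Rmult_le_pos; [now apply Hp|lra]. }
lra.
Qed.

Lemma Rabs_diff_le_of_derive (h dh : R -> R) (a b C : R) :
  a <= b ->
  (forall t, a <= t <= b -> continuous h t) ->
  (forall t, a < t < b -> is_derive h t (dh t)) ->
  (forall t, a < t < b -> Rabs (dh t) <= C) ->
  Rabs (h b - h a) <= C * (b - a).
Proof.
intros [Hab| ->] Hc Hd Hp.
- destruct (mean_value h dh a b Hab Hc Hd) as [c [Hcab ->]].
  rewrite Rabs_mult, (Rabs_pos_eq (b - a)) by lra.
  apply Rmult_le_compat_r; [lra|now apply Hp].
- rewrite !Rminus_diag, Rabs_R0. lra.
Qed.

Lemma continuous_bounded (h : R -> R) (a b : R) :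
  (forall t, a <= t <= b -> continuous h t) ->
  exists K, 0 < K /\ forall t, a <= t <= b -> Rabs (h t) <= K.
Proof.
intros Hc. destruct (Rle_lt_dec a b) as [Hab|Hab].
- destruct (continuity_ab_maj (fun t => Rabs (h t)) a b Hab) as [m [Hm _]].
  { intros c Hcab. apply continuity_pt_filterlim.
    apply (continuous_comp h Rabs); [now apply Hc|apply continuous_Rabs]. }
  exists (Rabs (h m) + 1). split; [assert (H := Rabs_pos (h m)); lra|].
  intros t Ht. specialize (Hm t Ht). lra.
- exists 1. split; [lra|]. intros t Ht. lra.
Qed.

Lemma uniformly_continuous (h : R -> R) (a b eps : R) :
  (forall t, a <= t <= b -> continuous h t) -> 0 < eps ->
  exists d, 0 < d /\ forall s t, a <= s <= b -> a <= t <= b ->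
    Rabs (t - s) < d -> Rabs (h t - h s) < eps.
Proof.
intros Hc He.
destruct (unifcont_1d h a b Hc (mkposreal _ He)) as [d Hd].
exists d. split; [apply cond_pos|].
intros s t Hs Ht Hst. apply NNPP. intros Hn. apply (Hd s t Hs Ht Hst). exact Hn.
Qed.

Lemma ex_RInt_of_continuous (h : R -> R) (a b : R) :
  a <= b -> (forall t, a <= t <= b -> continuous h t) -> ex_RInt h a b.
Proof.
intros Hab Hc. apply (ex_RInt_continuous (V := R_CompleteNormedModule)). intros z.
rewrite Rmin_left, Rmax_right by exact Hab. apply Hc.
Qed.

Lemma RInt_Chasles_R (h : R -> R) (a b c : R) :
  ex_RInt h a b -> ex_RInt h b c -> RInt h a b + RInt h b c = RInt h a c.
Proof. exact (RInt_Chasles h a b c). Qed.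

Lemma RInt_diff_R (g h : R -> R) (a b : R) :
  ex_RInt g a b -> ex_RInt h a b ->
  RInt g a b - RInt h a b = RInt (fun s => g s - h s) a b.
Proof. intros Hg Hh. symmetry. exact (RInt_minus g h a b Hg Hh). Qed.

Lemma RInt_scal_R (h : R -> R) (a b l : R) :
  ex_RInt h a b -> RInt (fun s => l * h s) a b = l * RInt h a b.
Proof. exact (RInt_scal h a b l). Qed.

Lemma ex_RInt_scal_R (h : R -> R) (a b l : R) :
  ex_RInt h a b -> ex_RInt (fun s => l * h s) a b.
Proof. exact (ex_RInt_scal h a b l). Qed.

Lemma ex_RInt_diff_R (g h : R -> R) (a b : R) :
  ex_RInt g a b -> ex_RInt h a b -> ex_RInt (fun s => g s - h s) a b.
Proof. exact (ex_RInt_minus g h a b). Qed.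

Lemma continuous_mult_R (g h : R -> R) (t : R) :
  continuous g t -> continuous h t -> continuous (fun s => g s * h s) t.
Proof. exact (continuous_mult g h t). Qed.

Lemma continuous_translate (c t : R) : continuous (fun s => c - s) t.
Proof. apply (continuous_minus (fun _ => c) (fun s => s)); [apply continuous_const|apply continuous_id]. Qed.

Lemma is_derive_RInt_of_continuous (h : R -> R) (a b lo hi : R) :
  lo < b < hi -> lo < a < hi -> (forall t, lo < t < hi -> continuous h t) ->
  is_derive (fun t => RInt h a t) b (h b).
Proof.
intros Hb Ha Hc. apply is_derive_RInt with a.
- apply (locally_interval _ b lo hi); [apply Hb|apply Hb|].
  intros t Ht1 Ht2. apply (RInt_correct h a t). apply (ex_RInt_continuous (V := R_CompleteNormedModule)).
  intros z Hz. apply Hc. revert Hz Ht1 Ht2. simpl. unfold Rmin, Rmax.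
  destruct (Rle_dec a t); lra.
- now apply Hc.
Qed.

Lemma is_derive_continuous (h : R -> R) (t l : R) : is_derive h t l -> continuous h t.
Proof. intros H. apply (ex_derive_continuous h). now exists l. Qed.

Definition conv (w g : R -> R) (t : R) : R := RInt (fun s => w (t - s) * g s) 0 t.

Lemma continuous_conv_integrand (w g : R -> R) (t s : R) :
  continuous w (t - s) -> continuous g s -> continuous (fun r => w (t - r) * g r) s.
Proof.
intros Hw Hg. apply continuous_mult_R; [|exact Hg].
apply (continuous_comp (fun r => t - r) w); [apply continuous_translate|exact Hw].
Qed.

(** * Ultrafilter limits *)

(** Extends the filter of cofinal segments of [nat] to an ultrafilter and translates it to
    Coquelicot's filters, where properness says that every member is inhabited. *)
Lemma ultrafilter_eventually :
  exists U : (nat -> Prop) -> Prop,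
    ProperFilter U /\
    (forall n, U (fun m => (n <= m)%nat)) /\
    (forall A, U A \/ U (fun n => ~ A n)).
Proof.
assert (HF : @filter.ProperFilter nat (@eventually : (nat -> Prop) -> Prop)).
{ split.
  - intros [N H]. exact (H N (le_n N)).
  - split.
    + exists 0%nat. intros; exact I.
    + intros P Q. apply (filter_and (F := eventually)).
    + intros P Q HPQ [N H]. exists N. intros n Hn. apply HPQ. now apply H. }
destruct (filter.ultraFilterLemma HF) as [U [HU HFU]].
assert (HUF := @filter.filter_filter _ _ (filter.ultra_proper (F := U))).
exists U. split; [|split].
- split.
  + intros P HP. apply NNPP. intros Hn.
    apply (@filter.filter_not_empty _ U (filter.ultra_proper (F := U))).
    refine (@filter.filterS _ U HUF P _ _ HP). intros n Pn. apply Hn. now exists n.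
  + split.
    * apply (@filter.filterT _ U HUF).
    * intros P Q HP HQ. exact (@filter.filterI _ U HUF P Q HP HQ).
    * intros P Q HPQ. exact (@filter.filterS _ U HUF P Q HPQ).
- intros n. apply HFU. exists n. now intros.
- intros A. apply (filter.in_ultra_setVsetC A HU).
Qed.

Section UltraLimit.

Variable U : (nat -> Prop) -> Prop.
Hypothesis U_filter : ProperFilter U.
Hypothesis U_ultra : forall A, U A \/ U (fun n => ~ A n).

Lemma ultrafilter_limit (a : nat -> R) (K : R) :
  (forall n, Rabs (a n) <= K) ->
  exists l, forall eps, 0 < eps -> U (fun n => Rabs (a n - l) < eps).
Proof.
intros HK.
assert (HK' : forall n, - K <= a n <= K).
{ intros n. apply Rabs_le_between. apply HK. }
(* The limit is the supremum of the levels lying below [U]-almost all terms. The ultrafilter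
   dichotomy turns failure of [l + eps] to be such a level, and of [l - eps] to be an upper bound,
   into statements about [U]-almost all terms. *)
destruct (completeness (fun r => U (fun n => r <= a n))) as [l [Hub Hlub]].
- exists K. intros r Hr. destruct (filter_ex _ Hr) as [n Hn].
  specialize (HK' n). lra.
- exists (- K). apply filter_forall. apply HK'.
- exists l. intros eps He.
  assert (H1 : U (fun n => ~ l + eps <= a n)).
  { destruct (U_ultra (fun n => l + eps <= a n)) as [H|H]; [|exact H].
    specialize (Hub _ H). lra. }
  assert (H2 : U (fun n => l - eps < a n)).
  { destruct (U_ultra (fun n => l - eps < a n)) as [H|H]; [exact H|].
    exfalso. cut (l <= l - eps); [lra|]. apply Hlub. intros r Hr.
    destruct (filter_ex _ (filter_and _ _ H Hr)) as [n [Hn1 Hn2]]. lra. }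
  generalize (filter_and _ _ H1 H2). apply filter_imp.
  intros n [Hn1 Hn2]. apply Rabs_lt_between'. lra.
Qed.

(** Pointwise limits along [U] exist by boundedness and inherit the Lipschitz constant. Uniformity
    on a compact interval needs only finitely many grid points, and a filter is closed under finite
    intersections. *)
Lemma ultrafilter_limit_lipschitz (y : nat -> R -> R) (K C : R) :
  (forall n t, Rabs (y n t) <= K) ->
  (forall n s t, Rabs (y n t - y n s) <= C * Rabs (t - s)) ->
  exists z : R -> R,
    (forall s t, Rabs (z t - z s) <= C * Rabs (t - s)) /\
    (forall t, Rabs (z t) <= K) /\
    (forall B eps, 0 < eps ->
       U (fun n => forall t, 0 <= t <= B -> Rabs (y n t - z t) <= eps)).
Proof.
intros HK HC.
destruct (choice
  (fun t l => forall eps, 0 < eps -> U (fun n => Rabs (y n t - l) < eps))) as [z Hz].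
{ intros t. apply ultrafilter_limit with K. intros n. apply HK. }
assert (HzC : forall s t, Rabs (z t - z s) <= C * Rabs (t - s)).
{ intros s t. apply le_epsilon. intros eps He.
  assert (He2 : 0 < eps / 2) by lra.
  destruct (filter_ex _ (filter_and _ _ (Hz s _ He2) (Hz t _ He2))) as [n [H1 H2]].
  specialize (HC n s t). revert H1 H2 HC.
  generalize (C * Rabs (t - s)). unfold Rabs. intros r.
  repeat destruct Rcase_abs; lra. }
exists z. split; [exact HzC|split].
{ intros t. apply le_epsilon. intros eps He.
  destruct (filter_ex _ (Hz t _ He)) as [n H1].
  specialize (HK n t). revert H1 HK. unfold Rabs.
  repeat destruct Rcase_abs; lra. }
intros B eps He.
assert (HC0 : 0 <= C).
{ specialize (HC 0%nat 0 1). rewrite Rminus_0_r, Rabs_R1 in HC.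
  assert (H := Rabs_pos (y 0%nat 1 - y 0%nat 0)). lra. }
(* Mesh of the grid: within one cell [y n] and [z] each move by at most [eps / 4], which leaves
   [eps / 2] for their distance at the grid point. The summand 1 covers [C = 0]. *)
set (h := eps / (4 * (C + 1))).
assert (Hh : 0 < h) by (apply Rdiv_lt_0_compat; lra).
assert (HCh : C * h <= eps / 4).
{ unfold h. replace (C * (eps / (4 * (C + 1)))) with (eps / 4 * (C / (C + 1))) by (field; lra).
  rewrite <- (Rmult_1_r (eps / 4)) at 2. apply Rmult_le_compat_l; [lra|].
  apply Rle_div_l; lra. }
assert (HN : forall N, U (fun n => forall t, 0 <= t <= INR N * h -> Rabs (y n t - z t) <= eps)).
{ induction N as [|N IH].
  - generalize (Hz 0 eps He). apply filter_imp. intros n Hn t Ht.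
    simpl in Ht. replace t with 0 by lra. lra.
  - assert (He2 : 0 < eps / 2) by lra.
    generalize (filter_and _ _ IH (Hz (INR N * h) _ He2)). apply filter_imp.
    intros n [H1 H2] t Ht. destruct (Rle_lt_dec t (INR N * h)) as [Hl|Hl].
    + apply H1. lra.
    + rewrite S_INR in Ht.
      assert (Hd : C * Rabs (t - INR N * h) <= eps / 4).
      { rewrite Rabs_pos_eq by lra. apply Rle_trans with (C * h); [|exact HCh].
        apply Rmult_le_compat_l; lra. }
      specialize (HC n (INR N * h) t). specialize (HzC (INR N * h) t).
      revert HC HzC H2 Hd. generalize (C * Rabs (t - INR N * h)). intros r.
      unfold Rabs. repeat destruct Rcase_abs; lra. }
destruct (INR_unbounded (B / h)) as [N HB].
generalize (HN N). apply filter_imp. intros n Hn t Ht. apply Hn.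
apply Rlt_div_l in HB; [lra|exact Hh].
Qed.

End UltraLimit.

(** * Continuity and bounds for convolutions *)

Lemma continuous_of_eps (h : R -> R) (t : R) :
  (forall eps, 0 < eps -> exists d, 0 < d /\
     forall s, Rabs (s - t) < d -> Rabs (h s - h t) < eps) ->
  continuous h t.
Proof.
intros H. apply filterlim_locally. intros eps.
destruct (H eps (cond_pos eps)) as [d [Hd Hs]].
exists (mkposreal d Hd). intros s. exact (Hs s).
Qed.

Lemma Rabs_RInt_le (h : R -> R) (a b M : R) :
  ex_RInt h a b ->
  (forall t, Rmin a b <= t <= Rmax a b -> Rabs (h t) <= M) ->
  Rabs (RInt h a b) <= Rabs (b - a) * M.
Proof.
intros He Hb. destruct (Rle_lt_dec a b) as [Hab|Hab].
- rewrite Rmin_left, Rmax_right in Hb by exact Hab.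
  rewrite (Rabs_pos_eq (b - a)) by lra. now apply abs_RInt_le_const.
- rewrite Rmin_right, Rmax_left in Hb by lra.
  rewrite <- (opp_RInt_swap h b a) by now apply ex_RInt_swap.
  change (Rabs (- RInt h b a) <= Rabs (b - a) * M).
  rewrite Rabs_Ropp, (Rabs_minus_sym b a), (Rabs_pos_eq (a - b)) by lra.
  apply abs_RInt_le_const; [lra| |exact Hb]. now apply ex_RInt_swap.
Qed.

Lemma ex_RInt_of_continuous_everywhere (h : R -> R) (a b : R) :
  (forall t, continuous h t) -> ex_RInt h a b.
Proof.
intros Hc. apply (ex_RInt_continuous (V := R_CompleteNormedModule)). now intros.
Qed.

Lemma Rabs_mult_le (a b A B : R) : Rabs a <= A -> Rabs b <= B -> Rabs (a * b) <= A * B.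
Proof.
intros Ha Hb. rewrite Rabs_mult. apply Rmult_le_compat; auto using Rabs_pos.
Qed.

(** The time enters both the kernel and the upper limit. Splitting the integral up to [r] at [t],
    uniform continuity of [w] controls the change of kernel on the common interval, and boundedness
    controls the short remaining piece. *)
Lemma continuous_conv (w g : R -> R) :
  (forall t, continuous w t) -> (forall t, continuous g t) ->
  forall t, continuous (conv w g) t.
Proof.
intros Hw Hg t.
assert (Hi : forall r s, continuous (fun s => w (r - s) * g s) s).
{ intros r s. apply continuous_conv_integrand; auto. }
set (B := Rabs t + 1).
assert (HB : 1 <= B) by (assert (H := Rabs_pos t); unfold B; lra).
assert (HtB : - B <= t - 1 /\ t + 1 <= B).
{ unfold B. unfold Rabs. destruct Rcase_abs; lra. }
destruct (continuous_bounded w (- (2 * B)) (2 * B)) as [Kw [HKw Hwb]]; [now intros|].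
destruct (continuous_bounded g (- B) B) as [Kg [HKg Hgb]]; [now intros|].
apply continuous_of_eps. intros eps He.
destruct (uniformly_continuous w (- (2 * B)) (2 * B) (eps / (4 * (B * Kg)))) as [d [Hd Hu]].
{ now intros. }
{ apply Rdiv_lt_0_compat; [exact He|]. apply Rmult_lt_0_compat; [lra|].
  apply Rmult_lt_0_compat; lra. }
assert (HK : 0 < Kw * Kg) by (apply Rmult_lt_0_compat; lra).
exists (Rmin 1 (Rmin d (eps / (4 * (Kw * Kg))))). split.
{ repeat apply Rmin_pos; try lra. apply Rdiv_lt_0_compat; lra. }
intros r Hr.
assert (Hr1 : Rabs (r - t) < 1) by (eapply Rlt_le_trans; [exact Hr|apply Rmin_l]).
assert (Hr2 : Rabs (r - t) < d).
{ eapply Rlt_le_trans; [exact Hr|]. eapply Rle_trans; [apply Rmin_r|apply Rmin_l]. }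
assert (Hr3 : Rabs (r - t) < eps / (4 * (Kw * Kg))).
{ eapply Rlt_le_trans; [exact Hr|]. eapply Rle_trans; [apply Rmin_r|apply Rmin_r]. }
assert (HrB : - B <= r <= B) by (apply Rabs_lt_between in Hr1; lra).
unfold conv.
rewrite <- (RInt_Chasles_R _ 0 t r); try (apply ex_RInt_of_continuous_everywhere; auto).
match goal with |- Rabs (?a + ?b - ?c) < _ => replace (a + b - c) with ((a - c) + b) by ring end.
eapply Rle_lt_trans; [apply Rabs_triang|].
rewrite RInt_diff_R; try (apply ex_RInt_of_continuous_everywhere; auto).
assert (H1 : Rabs (RInt (fun s => w (r - s) * g s - w (t - s) * g s) 0 t) <= eps / 4).
{ eapply Rle_trans.
  - apply Rabs_RInt_le with (M := eps / (4 * (B * Kg)) * Kg).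
    + apply ex_RInt_diff_R; apply ex_RInt_of_continuous_everywhere; auto.
    + intros s Hs. replace (w (r - s) * g s - w (t - s) * g s) with ((w (r - s) - w (t - s)) * g s) by ring.
      assert (Hs' : - B <= s <= B).
      { revert Hs. unfold Rmin, Rmax. destruct Rle_dec; lra. }
      apply Rabs_mult_le; [left; apply Hu|now apply Hgb].
      * lra. * lra. * now replace (r - s - (t - s)) with (r - t) by ring.
  - rewrite Rminus_0_r. apply Rle_trans with (B * (eps / (4 * (B * Kg)) * Kg)).
    + apply Rmult_le_compat_r; [|unfold B; lra]. apply Rmult_le_pos; [|lra].
      apply Rlt_le, Rdiv_lt_0_compat; [lra|].
      apply Rmult_lt_0_compat; [lra|]. apply Rmult_lt_0_compat; lra.
    + right. field. split; lra. }
assert (H2 : Rabs (RInt (fun s => w (r - s) * g s) t r) <= eps / 4).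
{ eapply Rle_trans.
  - apply Rabs_RInt_le with (M := Kw * Kg).
    + apply ex_RInt_of_continuous_everywhere; auto.
    + intros s Hs. assert (Hs' : - B <= s <= B).
      { revert Hs. unfold Rmin, Rmax. destruct Rle_dec; lra. }
      apply Rabs_mult_le; [apply Hwb; lra|now apply Hgb].
  - apply Rlt_div_r in Hr3; lra. }
lra.
Qed.

Lemma Rabs_conv_le (w g : R -> R) (t B Kw M : R) :
  (forall t, continuous w t) -> (forall t, continuous g t) ->
  0 <= t <= B ->
  (forall s, 0 <= s <= B -> Rabs (w s) <= Kw) ->
  (forall s, 0 <= s <= B -> Rabs (g s) <= M) ->
  Rabs (conv w g t) <= B * (Kw * M).
Proof.
intros Hw Hg Ht HKw HM. eapply Rle_trans.
- apply abs_RInt_le_const with (M := Kw * M); [lra| |].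
  + apply ex_RInt_of_continuous_everywhere. intros s. apply continuous_conv_integrand; auto.
  + intros s Hs. apply Rabs_mult_le; [apply HKw|apply HM]; lra.
- apply Rmult_le_compat_r; [|lra].
  apply Rmult_le_pos; (eapply Rle_trans; [apply Rabs_pos|]);
    [apply (HKw t)|apply (HM t)]; lra.
Qed.

Lemma conv_ext (w v g h : R -> R) (t : R) :
  0 <= t ->
  (forall s, 0 < s < t -> w s = v s) -> (forall s, 0 < s < t -> g s = h s) ->
  conv w g t = conv v h t.
Proof.
intros Ht Hw Hg. apply RInt_ext. intros s.
rewrite Rmin_left, Rmax_right by exact Ht. intros Hs.
rewrite Hw, Hg by lra. reflexivity.
Qed.

Lemma continuous_Rmin_l (c t : R) : continuous (fun s => Rmin s c) t.
Proof.
apply continuous_of_eps. intros eps He. exists eps. split; [exact He|].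
intros s. unfold Rmin, Rabs. repeat destruct Rle_dec; repeat destruct Rcase_abs; lra.
Qed.

Lemma continuous_Rmax_l (c t : R) : continuous (fun s => Rmax s c) t.
Proof.
apply continuous_of_eps. intros eps He. exists eps. split; [exact He|].
intros s. unfold Rmax, Rabs. repeat destruct Rle_dec; repeat destruct Rcase_abs; lra.
Qed.

Lemma is_derive_RInt_everywhere (h : R -> R) (a b : R) :
  (forall t, continuous h t) -> is_derive (fun t => RInt h a t) b (h b).
Proof.
intros Hc. apply is_derive_RInt_of_continuous with (Rmin a b - 1) (Rmax a b + 1); auto;
  unfold Rmin, Rmax; destruct Rle_dec; lra.
Qed.

(** * Continuation of bounded solutions *)

Section Continuation.

Variables (w f X : R -> R) (S M : R).
Hypothesis S_pos : 0 < S.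
Hypothesis w_cont : forall t, continuous w t.
Hypothesis f_cont : forall u, continuous f u.
Hypothesis f_bound : forall u, Rabs (f u) <= M.
Hypothesis X_cont : forall t, continuous X t.
Hypothesis X_eq : forall t, 0 < t < S -> is_derive X t (conv w (fun s => f (X s)) t).

(** The integral starts at [S], so up to time [S] the value is that of [X] whatever [y] is. A fixed
    point on an interval reaching past [S] thus continues [X], and the clamps make the formula
    meaningful and continuous on the whole line. *)
Let picard (y : R -> R) (t : R) : R :=
  X (Rmin t S) + RInt (conv w (fun s => f (y s))) S (Rmax t S).

Lemma continuous_f_comp (y : R -> R) :
  (forall t, continuous y t) -> forall t, continuous (fun s => f (y s)) t.
Proof. intros Hy t. now apply (continuous_comp y f). Qed.

Lemma continuous_conv_f_comp (y : R -> R) :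
  (forall t, continuous y t) -> forall t, continuous (conv w (fun s => f (y s))) t.
Proof. intros Hy. apply continuous_conv; [exact w_cont|now apply continuous_f_comp]. Qed.

Lemma continuous_picard (y : R -> R) :
  (forall t, continuous y t) -> forall t, continuous (picard y) t.
Proof.
intros Hy t. apply (continuous_plus (fun t => X (Rmin t S))).
- apply (continuous_comp (fun t => Rmin t S) X); [apply continuous_Rmin_l|apply X_cont].
- apply (continuous_comp (fun t => Rmax t S) (fun t => RInt (conv w (fun s => f (y s))) S t));
    [apply continuous_Rmax_l|].
  eapply is_derive_continuous, is_derive_RInt_everywhere. now apply continuous_conv_f_comp.
Qed.

Lemma picard_ext (y z : R -> R) (t : R) :
  (forall s, 0 <= s <= t -> y s = z s) -> picard y t = picard z t.
Proof.
intros Hyz. unfold picard. f_equal. apply RInt_ext. intros r Hr.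
rewrite Rmin_left, Rmax_right in Hr by apply Rmax_r.
assert (r < t) by (revert Hr; unfold Rmax; destruct Rle_dec; lra).
apply conv_ext; [lra|reflexivity|]. intros s Hs. rewrite Hyz by lra. reflexivity.
Qed.

(* Tonelli's scheme: with the delay [h] the equation can be solved step by step. *)
Lemma delayed_solution (h B : R) :
  0 < h -> exists y, (forall t, continuous y t) /\
    forall t, t <= B -> y t = picard y (Rmax (t - h) 0).
Proof.
intros Hh.
set (Y := fix Y k := match k with O => fun _ => X 0
                     | Datatypes.S k => fun t => picard (Y k) (Rmax (t - h) 0) end).
assert (Yc : forall k t, continuous (Y k) t).
{ induction k as [|k IH]; intros t.
  - apply continuous_const.
  - apply (continuous_comp (fun t => Rmax (t - h) 0) (picard (Y k))).
    + apply (continuous_comp (fun t => t - h) (fun t => Rmax t 0)); [|apply continuous_Rmax_l].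
      apply (continuous_minus (fun t => t) (fun _ => h)); [apply continuous_id|apply continuous_const].
    + now apply continuous_picard. }
(* The value at [t] reads the previous iterate only up to [t - h], so each iteration settles one
   more interval of length [h]. For [t <= 0] the clamp evaluates [picard] at 0, which gives [X 0]
   for every iterate. *)
assert (Ys : forall k t, t <= INR k * h -> Y (Datatypes.S k) t = Y k t).
{ induction k as [|k IH]; intros t Ht.
  - simpl in *. rewrite Rmax_right by lra. unfold picard.
    rewrite Rmin_left, Rmax_right by lra. rewrite RInt_point. apply Rplus_0_r.
  - rewrite S_INR in Ht. change (picard (Y (Datatypes.S k)) (Rmax (t - h) 0) = picard (Y k) (Rmax (t - h) 0)).
    apply picard_ext. intros s Hs. apply IH.
    assert (0 <= INR k * h) by (apply Rmult_le_pos; [apply pos_INR|lra]).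
    revert Hs. unfold Rmax. destruct Rle_dec; lra. }
destruct (INR_unbounded (B / h)) as [k HB].
apply Rlt_div_l in HB; [|exact Hh].
exists (Y k). split; [apply Yc|].
intros t Ht. rewrite <- Ys by lra. reflexivity.
Qed.

(** As [f] is bounded, [picard] sends every continuous function to one with the same bound [K] and
    Lipschitz constant [2 * C] on [[0, B]]. The delayed solutions inherit both, and with delays
    tending to 0 their ultrafilter limit is a fixed point. *)
Lemma continuation_step : exists y : R -> R,
  (forall t, continuous y t) /\
  (forall t, 0 <= t <= S -> y t = X t) /\
  (forall t, 0 < t < S + 1 -> is_derive y t (conv w (fun s => f (y s)) t)).
Proof.
set (B := S + 1).
assert (HB0 : 0 <= B) by (unfold B; lra).
destruct (continuous_bounded w 0 B) as [Kw [HKw Hwb]]; [now intros|].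
assert (HM : 0 <= M) by (eapply Rle_trans; [apply Rabs_pos|apply (f_bound 0)]).
set (C := B * (Kw * M)).
assert (HKM : 0 <= Kw * M) by (apply Rmult_le_pos; lra).
assert (HC : 0 <= C) by (apply Rmult_le_pos; [unfold B; lra|exact HKM]).
assert (convb : forall y, (forall t, continuous y t) -> forall t, 0 <= t <= B ->
  Rabs (conv w (fun s => f (y s)) t) <= C).
{ intros y Hy t Ht. apply Rabs_conv_le; auto. now apply continuous_f_comp. }
assert (Xlip : forall s t, 0 <= s <= t -> t <= S -> Rabs (X t - X s) <= C * (t - s)).
{ intros s t Hst HtS. apply Rabs_diff_le_of_derive with (conv w (fun s => f (X s))); auto.
  - lra.
  - intros r Hr. apply X_eq. lra.
  - intros r Hr. apply convb; auto. unfold B. lra. }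
assert (pexi : forall y, (forall t, continuous y t) -> forall a b, ex_RInt (conv w (fun s => f (y s))) a b).
{ intros y Hy a b. apply ex_RInt_of_continuous_everywhere. now apply continuous_conv_f_comp. }
assert (plip0 : forall y, (forall t, continuous y t) -> forall s t, 0 <= s <= t -> t <= B ->
  Rabs (picard y t - picard y s) <= 2 * C * (t - s)).
{ intros y Hy s t Hst HtB. unfold picard.
  rewrite <- (RInt_Chasles_R _ S (Rmax s S) (Rmax t S)) by now apply pexi.
  match goal with |- Rabs (?a + (?b + ?d) - (?c + ?b)) <= _ =>
    replace (a + (b + d) - (c + b)) with ((a - c) + d) by ring end.
  eapply Rle_trans; [apply Rabs_triang|].
  assert (H1 : Rabs (X (Rmin t S) - X (Rmin s S)) <= C * (Rmin t S - Rmin s S)).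
  { apply Xlip; unfold Rmin; repeat destruct Rle_dec; lra. }
  assert (H2 : Rabs (RInt (conv w (fun s => f (y s))) (Rmax s S) (Rmax t S)) <= (Rmax t S - Rmax s S) * C).
  { apply abs_RInt_le_const; [unfold Rmax; repeat destruct Rle_dec; lra|now apply pexi|].
    intros r Hr. apply convb; [exact Hy|]. revert Hr. unfold B in *. unfold Rmax; repeat destruct Rle_dec; lra. }
  assert (H3 : C * (Rmin t S - Rmin s S) <= C * (t - s)).
  { apply Rmult_le_compat_l; [exact HC|]. unfold Rmin; repeat destruct Rle_dec; lra. }
  assert (H4 : C * (Rmax t S - Rmax s S) <= C * (t - s)).
  { apply Rmult_le_compat_l; [exact HC|]. unfold Rmax; repeat destruct Rle_dec; lra. }
  lra. }
assert (plip : forall y, (forall t, continuous y t) -> forall s t, 0 <= s <= B -> 0 <= t <= B ->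
  Rabs (picard y t - picard y s) <= 2 * C * Rabs (t - s)).
{ intros y Hy s t Hs Ht. destruct (Rle_lt_dec s t) as [Hst|Hst].
  - rewrite (Rabs_pos_eq (t - s)) by lra. apply plip0; auto; lra.
  - rewrite (Rabs_minus_sym (picard y t)), (Rabs_minus_sym t), (Rabs_pos_eq (s - t)) by lra.
    apply plip0; auto; lra. }
assert (p0 : forall y, picard y 0 = X 0).
{ intros y. unfold picard. rewrite Rmin_left, Rmax_right by lra. rewrite RInt_point. apply Rplus_0_r. }
set (K := Rabs (X 0) + 2 * C * B).
assert (pbound : forall y, (forall t, continuous y t) -> forall t, 0 <= t <= B ->
  Rabs (picard y t) <= K).
{ intros y Hy t Ht.
  assert (H1 := plip y Hy 0 t (conj (Rle_refl 0) HB0) Ht).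
  rewrite p0, Rminus_0_r, (Rabs_pos_eq t) in H1 by apply Ht.
  assert (H2 : 2 * C * t <= 2 * C * B) by (apply Rmult_le_compat_l; lra).
  unfold K. revert H1 H2. generalize (2 * C * t) (2 * C * B).
  intros a b. unfold Rabs. repeat destruct Rcase_abs; lra. }
set (h := fun n => / (INR n + 1)).
assert (Hh : forall n, 0 < h n).
{ intros n. apply Rinv_0_lt_compat. assert (H := pos_INR n). lra. }
destruct (choice (fun n y => (forall t, continuous y t) /\
  forall t, t <= B -> y t = picard y (Rmax (t - h n) 0))) as [Y HY].
{ intros n. now apply delayed_solution. }
(* The limit lemma wants bounds for all real times, whereas those of [picard] hold on [[0, B]];
   composing with this 1-Lipschitz projection supplies them. *)
set (clamp := fun t => Rmin (Rmax t 0) B).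
assert (clamp_in : forall t, 0 <= clamp t <= B).
{ intros t. unfold clamp, B, Rmin, Rmax. repeat destruct Rle_dec; lra. }
assert (clamp_id : forall t, 0 <= t <= B -> clamp t = t).
{ intros t Ht. unfold clamp. rewrite Rmax_left, Rmin_left; lra. }
assert (clamp_lip : forall s t, Rabs (clamp t - clamp s) <= Rabs (t - s)).
{ intros s t. unfold clamp, B, Rmin, Rmax, Rabs. repeat destruct Rle_dec; repeat destruct Rcase_abs; lra. }
assert (back_in : forall n t, 0 <= t <= B -> 0 <= Rmax (t - h n) 0 <= B).
{ intros n t Ht. specialize (Hh n). unfold Rmax. destruct Rle_dec; lra. }
destruct ultrafilter_eventually as [U [HU [Hev Hultra]]].
destruct (ultrafilter_limit_lipschitz U HU Hultra (fun n t => Y n (clamp t)) K (2 * C)) as [z [zlip [zb zU]]].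
{ intros n t. destruct (HY n) as [Yc Ye]. rewrite Ye by apply clamp_in.
  apply pbound; auto. }
{ intros n s t. destruct (HY n) as [Yc Ye]. rewrite !Ye by apply clamp_in.
  eapply Rle_trans; [apply plip; auto|]. apply Rmult_le_compat_l; [lra|].
  eapply Rle_trans; [|apply (clamp_lip s t)].
  generalize (clamp t) (clamp s). intros a b. unfold Rmax, Rabs.
  repeat destruct Rle_dec; repeat destruct Rcase_abs; lra. }
assert (zc : forall t, continuous z t).
{ intros t. apply continuous_of_eps. intros eps He. exists (eps / (2 * C + 1)).
  split; [apply Rdiv_lt_0_compat; lra|]. intros s Hs.
  apply Rlt_div_r in Hs; [|lra]. specialize (zlip t s).
  assert (H := Rabs_pos (s - t)). lra. }
assert (zfix : forall t, 0 <= t <= B -> z t = picard z t).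
{ intros t Ht. apply cond_eq. intros eps He.
  (* Three errors of at most [eps / 4] separate [z t] from [picard z t]: the distance from [Y n] to
     [z], the delay, and the change of argument under [picard]. In the last one the convolution
     costs a factor [B * Kw] and the outer integral at most [B], whence this modulus for [f]. *)
  destruct (uniformly_continuous f (- K) K (eps / (4 * (B * (B * Kw))))) as [d [Hd Hu]].
  { now intros. }
  { apply Rdiv_lt_0_compat; [exact He|]. repeat apply Rmult_lt_0_compat; unfold B; lra. }
  assert (He' : 0 < Rmin (eps / 4) (d / 2)) by (apply Rmin_pos; lra).
  destruct (INR_unbounded (2 * C / (eps / 4))) as [N HN].
  destruct (filter_ex _ (filter_and _ _ (zU B _ He') (Hev N))) as [n [H1 Hn]].
  destruct (HY n) as [Yc Ye].
  assert (Hyz : forall s, 0 <= s <= B -> Rabs (Y n s - z s) <= eps / 4 /\ Rabs (Y n s - z s) < d).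
  { intros s Hs. specialize (H1 s Hs). rewrite clamp_id in H1 by exact Hs.
    assert (Ha := Rmin_l (eps / 4) (d / 2)). assert (Hb := Rmin_r (eps / 4) (d / 2)). lra. }
  assert (E1 := proj1 (Hyz t Ht)).
  assert (E2 : Rabs (Y n t - picard (Y n) t) <= eps / 4).
  { rewrite (Ye t) at 1 by lra. eapply Rle_trans; [apply plip; auto|].
    apply Rle_trans with (2 * C * h n).
    - apply Rmult_le_compat_l; [lra|]. specialize (Hh n). unfold Rmax, Rabs.
      destruct Rle_dec; destruct Rcase_abs; lra.
    - unfold h. apply Rlt_div_l in HN; [|lra]. assert (HNn := le_INR _ _ Hn).
      apply Rle_div_l; [assert (H := pos_INR n); lra|].
      apply Rle_trans with (INR N * (eps / 4)); [lra|].
      rewrite (Rmult_comm (eps / 4)). apply Rmult_le_compat_r; lra. }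
  assert (E3 : Rabs (picard (Y n) t - picard z t) <= eps / 4).
  { unfold picard.
    match goal with |- Rabs (?a + ?b - (?a + ?c)) <= _ => replace (a + b - (a + c)) with (b - c) by ring end.
    rewrite RInt_diff_R by now apply pexi.
    eapply Rle_trans.
    - apply abs_RInt_le_const with (M := B * (Kw * (eps / (4 * (B * (B * Kw)))))); [apply Rmax_r| |].
      + apply ex_RInt_diff_R; now apply pexi.
      + intros r Hr.
        assert (HrB : 0 <= r <= B).
        { revert Hr. unfold B in *. unfold Rmax; destruct Rle_dec; lra. }
        assert (HfY := continuous_f_comp _ Yc). assert (Hfz := continuous_f_comp _ zc).
        replace (conv w (fun s => f (Y n s)) r - conv w (fun s => f (z s)) r)
          with (conv w (fun s => f (Y n s) - f (z s)) r).
        * apply Rabs_conv_le; auto.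
          -- intros s. now apply (continuous_minus (fun s => f (Y n s))).
          -- intros s Hs. destruct (Hyz s Hs) as [_ Hs'].
             assert (HYK : Rabs (Y n s) <= K).
             { rewrite Ye by apply Hs.
               apply pbound; auto. }
             left. apply Hu; [apply Rabs_le_between, zb|now apply Rabs_le_between|exact Hs'].
        * unfold conv. rewrite RInt_diff_R.
          -- apply RInt_ext. intros s _. apply Rmult_minus_distr_l.
          -- apply ex_RInt_of_continuous_everywhere. intros s. apply continuous_conv_integrand; auto.
          -- apply ex_RInt_of_continuous_everywhere. intros s. apply continuous_conv_integrand; auto.
    - apply Rle_trans with (B * (B * (Kw * (eps / (4 * (B * (B * Kw))))))).
      + apply Rmult_le_compat_r; [|unfold B in *; unfold Rmax; destruct Rle_dec; lra].
        apply Rmult_le_pos; [unfold B; lra|]. apply Rmult_le_pos; [lra|].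
        apply Rlt_le, Rdiv_lt_0_compat; [exact He|]. repeat apply Rmult_lt_0_compat; unfold B; lra.
      + right. field. split; unfold B; lra. }
  revert E1 E2 E3. unfold Rabs. repeat destruct Rcase_abs; lra. }
set (D := conv w (fun s => f (z s))).
assert (Dc : forall t, continuous D t) by now apply continuous_conv_f_comp.
assert (zX : forall t, 0 <= t <= S -> z t = X t).
{ intros t Ht. rewrite zfix by (unfold B; lra). unfold picard.
  rewrite Rmin_left, Rmax_right by lra. rewrite RInt_point. apply Rplus_0_r. }
(* The equation for [X] is known only before [S]. Writing [X] as an integral of [D] gives one
   formula for [z] on both sides of [S], so that [z] is differentiable at [S] as well. *)
assert (XQ : forall t, 0 <= t <= S -> X t = X 0 + RInt D 0 t).
{ intros t Ht.
  assert (H := Rabs_diff_le_of_derive (fun t => X t - RInt D 0 t) (fun _ => 0) 0 t 0 (proj1 Ht)).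
  cbv beta in H. rewrite RInt_point in H. change (zero : R) with 0 in H.
  rewrite Rminus_0_r, Rmult_0_l in H.
  cut (Rabs (X t - RInt D 0 t - X 0) <= 0).
  { unfold Rabs. destruct Rcase_abs; lra. }
  apply H.
  - intros r Hr. apply (continuous_minus X); [apply X_cont|].
    eapply is_derive_continuous, is_derive_RInt_everywhere, Dc.
  - intros r Hr. replace 0 with (conv w (fun s => f (X s)) r - D r).
    + apply (is_derive_minus X); [apply X_eq; lra|now apply is_derive_RInt_everywhere].
    + replace (D r) with (conv w (fun s => f (X s)) r); [ring|].
      apply conv_ext; [lra|reflexivity|]. intros s Hs. rewrite zX by lra. reflexivity.
  - intros r _. rewrite Rabs_R0. lra. }
assert (zQ : forall t, 0 <= t <= B -> z t = X 0 + RInt D 0 t).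
{ intros t Ht. rewrite zfix by exact Ht. unfold picard. fold D.
  destruct (Rle_lt_dec t S) as [HtS|HtS].
  - rewrite Rmin_left, Rmax_right, RInt_point by lra. rewrite XQ by lra. apply Rplus_0_r.
  - rewrite Rmin_right, Rmax_left by lra. rewrite XQ by lra.
    rewrite Rplus_assoc. f_equal. apply RInt_Chasles_R; now apply ex_RInt_of_continuous_everywhere. }
exists z. split; [exact zc|]. split; [exact zX|].
intros t Ht. apply is_derive_ext_loc with (fun t => X 0 + RInt D 0 t).
- apply (locally_interval _ t 0 B); [apply Ht|apply Ht|].
  intros s Hs1 Hs2. symmetry. apply zQ. simpl in *. lra.
- replace (conv w (fun s => f (z s)) t) with (0 + D t) by apply Rplus_0_l.
  apply (is_derive_plus (fun _ => X 0)); [exact (is_derive_const (K := R_AbsRing) (V := R_NormedModule) (X 0) t)|now apply is_derive_RInt_everywhere].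
Qed.

End Continuation.

(** * Integral estimates and limits from the left *)

Lemma Rabs_RInt_mult_le (p g : R -> R) (a b K : R) :
  a <= b ->
  ex_RInt (fun s => p s * g s) a b -> ex_RInt g a b ->
  (forall s, a <= s <= b -> Rabs (p s) <= K) ->
  (forall s, a <= s <= b -> 0 <= g s) ->
  Rabs (RInt (fun s => p s * g s) a b) <= K * RInt g a b.
Proof.
intros Hab Hpg Hg HK Hpos. rewrite <- RInt_scal_R by exact Hg.
eapply Rle_trans; [now apply abs_RInt_le|].
apply RInt_le; [exact Hab| |now apply ex_RInt_scal_R|].
- exact (ex_RInt_norm _ _ _ Hpg).
- intros s Hs. rewrite Rabs_mult, (Rabs_pos_eq (g s)) by (apply Hpos; lra).
  apply Rmult_le_compat_r; [apply Hpos; lra|apply HK; lra].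
Qed.

Lemma RInt_nonneg (h : R -> R) (a b : R) :
  a <= b -> (forall t, a <= t <= b -> continuous h t) ->
  (forall t, a <= t <= b -> 0 <= h t) -> 0 <= RInt h a b.
Proof.
intros Hab Hc Hp. apply RInt_ge_0; [exact Hab|now apply ex_RInt_of_continuous|].
intros t Ht. apply Hp. lra.
Qed.

Lemma RInt_ge_const (h : R -> R) (a b m : R) :
  a <= b -> (forall t, a <= t <= b -> continuous h t) ->
  (forall t, a <= t <= b -> m <= h t) -> m * (b - a) <= RInt h a b.
Proof.
intros Hab Hc Hp. replace (m * (b - a)) with (RInt (fun _ => m) a b).
- apply RInt_le; [exact Hab|apply ex_RInt_const|now apply ex_RInt_of_continuous|].
  intros t Ht. apply Hp. lra.
- rewrite RInt_const. apply Rmult_comm.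
Qed.

Lemma at_left_intro (P : R -> Prop) (a T : R) :
  a < T -> (forall t, a < t < T -> P t) -> at_left T P.
Proof.
intros Ha H. assert (Hd : 0 < T - a) by lra.
exists (mkposreal _ Hd). intros t Ht HtT. apply H.
change (Rabs (t - T) < T - a) in Ht. apply Rabs_lt_between in Ht. lra.
Qed.

Lemma at_left_elim (P : R -> Prop) (T : R) :
  at_left T P -> exists a, a < T /\ forall t, a < t < T -> P t.
Proof.
intros [d Hd]. exists (T - d). split; [assert (H := cond_pos d); lra|].
intros t Ht. apply Hd; [|apply Ht].
change (Rabs (t - T) < d). apply Rabs_lt_between. assert (H := cond_pos d); lra.
Qed.

Lemma filterlim_locally_intro {U : Type} (F : (U -> Prop) -> Prop) (h : U -> R) (l : R) :
  Filter F ->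
  (forall eps, 0 < eps -> F (fun t => Rabs (h t - l) < eps)) -> filterlim h F (locally l).
Proof.
intros HF H. apply filterlim_locally. intros eps. exact (H eps (cond_pos eps)).
Qed.

Lemma filterlim_locally_elim {U : Type} (F : (U -> Prop) -> Prop) (h : U -> R) (l : R) :
  Filter F ->
  filterlim h F (locally l) -> forall eps, 0 < eps -> F (fun t => Rabs (h t - l) < eps).
Proof.
intros HF H eps He. exact (proj1 (filterlim_locally h l) H (mkposreal _ He)).
Qed.

Lemma filterlim_mult_R {U : Type} (F : (U -> Prop) -> Prop) (g h : U -> R) (a b : R) :
  Filter F -> filterlim g F (locally a) -> filterlim h F (locally b) ->
  filterlim (fun t => g t * h t) F (locally (a * b)).
Proof.
intros HF Hg Hh. exact (filterlim_comp_2 _ _ _ Hg Hh (filterlim_mult a b)).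
Qed.

(** * The functions [prim f] and [F_B f] *)

Section Forcing.

Variable f : R -> R.
Hypothesis f_cont : forall u, 0 < u -> continuous f u.
Hypothesis f_pos : forall u, 0 < u -> 0 < f u.

Lemma ex_RInt_pos (a b : R) : 0 < a -> 0 < b -> ex_RInt f a b.
Proof.
intros Ha Hb. apply (ex_RInt_continuous (V := R_CompleteNormedModule)).
intros u Hu. apply f_cont. revert Hu. unfold Rmin. destruct Rle_dec; lra.
Qed.

Lemma RInt_pos (a b : R) : 0 < a <= b -> 0 <= RInt f a b.
Proof.
intros Hab. apply RInt_nonneg; [apply Hab| |]; intros u Hu.
- apply f_cont. lra.
- apply Rlt_le, f_pos. lra.
Qed.

(** Beyond some point [f] exceeds 1; on the remaining compact interval a bound on the continuous
    function [/ f] is a positive lower bound for [f]. *)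
Lemma lower_bound_pos :
  filterlim f (Rbar_locally p_infty) (Rbar_locally p_infty) ->
  forall a, 0 < a -> exists m, 0 < m /\ forall u, a <= u -> m <= f u.
Proof.
intros Hf a Ha.
destruct (Hf (fun v => 1 < v)) as [N HN]; [now exists 1|].
destruct (continuous_bounded (fun u => / f u) a (Rmax a (N + 1))) as [K [HK Hb]].
{ intros u Hu. apply continuous_Rinv_comp; [apply f_cont|apply Rgt_not_eq, f_pos]; lra. }
exists (Rmin 1 (/ K)). split.
{ apply Rmin_pos; [lra|now apply Rinv_0_lt_compat]. }
intros u Hu. destruct (Rle_lt_dec u (Rmax a (N + 1))) as [H|H].
- eapply Rle_trans; [apply Rmin_r|]. specialize (Hb u (conj Hu H)).
  assert (Hfu := f_pos u ltac:(lra)).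
  rewrite Rabs_pos_eq in Hb by now apply Rlt_le, Rinv_0_lt_compat.
  rewrite <- (Rinv_inv (f u)). apply Rinv_le_contravar; [now apply Rinv_0_lt_compat|exact Hb].
- eapply Rle_trans; [apply Rmin_l|]. apply Rlt_le, HN.
  assert (H' := Rmax_r a (N + 1)). lra.
Qed.

Section Primitive.

Hypothesis f_int0 : forall u, 0 < u -> ex_RInt_gen f (at_right 0) (at_point u).

Lemma prim_Chasles (a b : R) : 0 < a -> 0 < b -> prim f b = prim f a + RInt f a b.
Proof.
intros Ha Hb.
apply (is_RInt_gen_unique (V := R_CompleteNormedModule) f (prim f a + RInt f a b)).
apply (is_RInt_gen_Chasles f a (prim f a) (RInt f a b)).
- apply (RInt_gen_correct (V := R_CompleteNormedModule)). now apply f_int0.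
- apply (is_RInt_gen_at_point (V := R_NormedModule)). apply (RInt_correct f a b). now apply ex_RInt_pos.
Qed.

Lemma is_derive_prim (u : R) : 0 < u -> is_derive (prim f) u (f u).
Proof.
intros Hu. apply is_derive_ext_loc with (fun v => prim f u + RInt f u v).
- apply (locally_interval _ u 0 p_infty); [exact Hu|exact I|].
  intros v Hv _. symmetry. now apply prim_Chasles.
- replace (f u) with (0 + f u) by apply Rplus_0_l.
  apply (is_derive_plus (fun _ => prim f u)).
  + exact (is_derive_const (K := R_AbsRing) (V := R_NormedModule) (prim f u) u).
  + apply is_derive_RInt_of_continuous with 0 (u + 1); try lra.
    intros t Ht. apply f_cont. lra.
Qed.

(** The integral is improper at 0, hence a limit of the nonnegative proper integrals from [a] to
    [u]; some admissible [a] below [u] is within [eps] of the limit. *)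
Lemma prim_nonneg (u : R) : 0 < u -> 0 <= prim f u.
Proof.
intros Hu. apply le_epsilon. intros eps He.
assert (H := RInt_gen_correct f (f_int0 u Hu)).
specialize (H (ball (prim f u) (mkposreal _ He)) (locally_ball _ _)).
destruct H as [P Q HP HQ H].
destruct HP as [d Hd].
set (a := Rmin (d / 2) u).
assert (Hdp := cond_pos d).
assert (Ha : 0 < a) by (apply Rmin_pos; lra).
assert (Ha' : a <= u) by apply Rmin_r.
destruct (H a u) as [y [Hy1 Hy2]].
- apply Hd; [|exact Ha]. change (Rabs (a - 0) < d).
  rewrite Rminus_0_r, Rabs_pos_eq by lra. assert (H' := Rmin_l (d / 2) u). unfold a. lra.
- exact HQ.
- simpl in Hy1. apply is_RInt_unique in Hy1.
  assert (Hp := RInt_pos a u (conj Ha Ha')).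
  change (Rabs (y - prim f u) < eps) in Hy2. rewrite <- Hy1 in Hy2.
  apply Rabs_lt_between in Hy2. lra.
Qed.

Lemma prim_pos (u : R) : 0 < u -> 0 < prim f u.
Proof.
intros Hu. rewrite (prim_Chasles (u / 2) u) by lra.
assert (H1 := prim_nonneg (u / 2) ltac:(lra)).
cut (0 < RInt f (u / 2) u); [lra|].
apply RInt_gt_0; [lra| |]; intros t Ht; [apply f_pos|apply f_cont]; lra.
Qed.

Lemma continuous_inv_sqrt_prim (u : R) : 0 < u -> continuous (fun u => / sqrt (prim f u)) u.
Proof.
intros Hu. apply continuous_Rinv_comp.
- apply continuous_sqrt_comp. eapply is_derive_continuous. now apply is_derive_prim.
- apply Rgt_not_eq, sqrt_lt_R0. now apply prim_pos.
Qed.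

End Primitive.

End Forcing.

(** * Tails of convergent improper integrals *)

Section Tail.

Variables (G : R -> R) (eta : R).
Hypothesis G_cont : forall u, 0 < u -> continuous G u.
Hypothesis G_pos : forall u, 0 < u -> 0 < G u.
Hypothesis eta_pos : 0 < eta.
Hypothesis G_int : ex_RInt_gen G (at_point eta) (Rbar_locally p_infty).

Let tail (u : R) : R := RInt_gen G (at_point u) (Rbar_locally p_infty).

Lemma is_RInt_gen_tail (u : R) : 0 < u ->
  is_RInt_gen G (at_point u) (Rbar_locally p_infty) (RInt G u eta + tail eta).
Proof.
intros Hu. apply (is_RInt_gen_Chasles G eta (RInt G u eta) (tail eta)).
- apply (is_RInt_gen_at_point (V := R_NormedModule)). apply (RInt_correct G u eta). now apply ex_RInt_pos.
- now apply (RInt_gen_correct (V := R_CompleteNormedModule)).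
Qed.

Lemma tail_Chasles (u v : R) : 0 < u -> 0 < v -> tail u = RInt G u v + tail v.
Proof.
intros Hu Hv. unfold tail at 1 2.
rewrite (is_RInt_gen_unique _ _ (is_RInt_gen_tail u Hu)).
rewrite (is_RInt_gen_unique _ _ (is_RInt_gen_tail v Hv)).
rewrite <- Rplus_assoc. f_equal. symmetry. apply RInt_Chasles_R; now apply ex_RInt_pos.
Qed.

Lemma is_derive_tail (u : R) : 0 < u -> is_derive tail u (- G u).
Proof.
intros Hu. apply is_derive_ext_loc with (fun v => tail u - RInt G u v).
- apply (locally_interval _ u 0 p_infty); [exact Hu|exact I|].
  intros v Hv _. rewrite (tail_Chasles u v); [|exact Hu|exact Hv]. simpl. lra.
- replace (- G u) with (0 - G u) by apply Rminus_0_l.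
  apply (is_derive_minus (fun _ => tail u)).
  + exact (is_derive_const (K := R_AbsRing) (V := R_NormedModule) (tail u) u).
  + apply is_derive_RInt_of_continuous with 0 (u + 1); try lra.
    intros t Ht. apply G_cont. lra.
Qed.

Lemma filterlim_tail : filterlim tail (Rbar_locally p_infty) (locally 0).
Proof.
apply filterlim_locally_intro; [apply Rbar_locally_filter|]. intros eps He.
assert (H := RInt_gen_correct G G_int).
specialize (H (ball (tail eta) (mkposreal _ He)) (locally_ball _ _)).
destruct H as [P Q HP [N HN] H].
exists (Rmax N 0). intros b Hb.
assert (HbN : N < b) by (eapply Rle_lt_trans; [apply Rmax_l|exact Hb]).
assert (Hb0 : 0 < b) by (eapply Rle_lt_trans; [apply Rmax_r|exact Hb]).
destruct (H eta b HP (HN b HbN)) as [y [Hy1 Hy2]].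
simpl in Hy1. apply is_RInt_unique in Hy1.
change (Rabs (y - tail eta) < eps) in Hy2.
rewrite (tail_Chasles eta b), <- Hy1 in Hy2 by assumption.
rewrite <- Rabs_Ropp. replace (- (tail b - 0)) with (RInt G eta b - (RInt G eta b + tail b)) by ring.
exact Hy2.
Qed.

Lemma tail_nonneg (u : R) : 0 < u -> 0 <= tail u.
Proof.
intros Hu. apply le_epsilon. intros eps He.
destruct (filterlim_locally_elim _ _ _ _ filterlim_tail eps He) as [N HN].
set (v := Rmax u (N + 1)).
assert (Hv : N < v) by (assert (H := Rmax_r u (N + 1)); unfold v; lra).
assert (Huv : u <= v) by apply Rmax_l.
specialize (HN v Hv). rewrite (tail_Chasles u v) by lra.
assert (H := RInt_pos G G_cont G_pos u v (conj Hu Huv)).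
apply Rabs_lt_between in HN. lra.
Qed.

End Tail.

(** * Solutions with data extended to the whole line *)

(** Meant for [w] and [x] extended to negative arguments by their values at 0. Two-sided continuity
    at 0 then replaces one-sided limits, so the integration lemmas apply on closed intervals
    starting at 0. [f] is left on positive arguments, where [x] takes its values. *)
Record regular_solution (w f x : R -> R) (S : Rbar) : Prop := {
  reg_w_cont : forall u, continuous w u;
  reg_w_nonneg : forall u, 0 <= w u;
  reg_f_cont : forall u, 0 < u -> continuous f u;
  reg_f_pos : forall u, 0 < u -> 0 < f u;
  reg_x_cont : forall t : R, Rbar_lt t S -> continuous x t;
  reg_x_pos : forall t : R, Rbar_lt t S -> 0 < x t;
  reg_x_eq : forall t : R, 0 < t -> Rbar_lt t S -> is_derive x t (conv w (fun s => f (x s)) t) }.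

Section Solution.

Variables (w f x : R -> R) (S : Rbar).
Hypothesis reg : regular_solution w f x S.

Let g (s : R) : R := f (x s).

Lemma Rbar_lt_of_le (a b : R) : a <= b -> Rbar_lt b S -> Rbar_lt a S.
Proof. intros Hab. now apply (Rbar_le_lt_trans a b S). Qed.

Lemma sol_g_cont (t : R) : Rbar_lt t S -> continuous g t.
Proof.
intros Ht. apply (continuous_comp x f); [now apply (reg_x_cont _ _ _ _ reg)|].
apply (reg_f_cont _ _ _ _ reg). now apply (reg_x_pos _ _ _ _ reg).
Qed.

Lemma sol_g_pos (t : R) : Rbar_lt t S -> 0 < g t.
Proof.
intros Ht. apply (reg_f_pos _ _ _ _ reg). now apply (reg_x_pos _ _ _ _ reg).
Qed.

Lemma sol_ex_RInt_g (a b : R) : a <= b -> Rbar_lt b S -> ex_RInt g a b.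
Proof.
intros Hab Hb. apply ex_RInt_of_continuous; [exact Hab|].
intros t Ht. apply sol_g_cont. now apply Rbar_lt_of_le with b.
Qed.

Lemma sol_ex_RInt_conv (v : R -> R) (t a b : R) :
  (forall u, continuous v u) ->
  a <= b -> Rbar_lt b S -> ex_RInt (fun s => v (t - s) * g s) a b.
Proof.
intros Hv Hab Hb. apply ex_RInt_of_continuous; [exact Hab|].
intros s Hs. apply continuous_conv_integrand; [apply Hv|].
apply sol_g_cont. now apply Rbar_lt_of_le with b.
Qed.

Lemma sol_RInt_g_nonneg (a b : R) : a <= b -> Rbar_lt b S -> 0 <= RInt g a b.
Proof.
intros Hab Hb. apply RInt_nonneg; [exact Hab| |]; intros t Ht;
  [apply sol_g_cont|apply Rlt_le, sol_g_pos]; now apply Rbar_lt_of_le with b.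
Qed.

Lemma sol_RInt_g_Chasles (a b c : R) : a <= b <= c -> Rbar_lt c S ->
  RInt g a b + RInt g b c = RInt g a c.
Proof.
intros Hab Hc. apply RInt_Chasles_R; apply sol_ex_RInt_g; try easy.
now apply Rbar_lt_of_le with c.
Qed.

Lemma sol_is_derive_RInt_g (a t : R) : a < t -> Rbar_lt t S ->
  is_derive (fun t => RInt g a t) t (g t).
Proof.
intros Ha Ht.
assert (exists hi, t < hi /\ forall s, s < hi -> Rbar_lt s S) as [hi [Hhi Hs]].
{ destruct S as [T| |]; simpl in Ht |- *.
  - exists T. now split.
  - exists (t + 1). split; [lra|now intros].
  - easy. }
apply is_derive_RInt_of_continuous with (a - 1) hi; try lra.
intros r Hr. apply sol_g_cont. now apply Hs.
Qed.

(** The part of the integral before [a] is nonnegative and dropped; only lags up to [t - a] need a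
    lower bound on [w]. Taking [c] and [a] to be 0 yields the monotonicity of [x]. *)
Lemma sol_conv_ge (c a t : R) :
  0 <= a <= t -> Rbar_lt t S ->
  (forall u, 0 <= u <= t - a -> c <= w u) -> c * RInt g a t <= conv w g t.
Proof.
intros Ha Ht Hc. assert (Hw := reg_w_cont _ _ _ _ reg).
unfold conv. rewrite <- (RInt_Chasles_R _ 0 a t).
2:{ apply sol_ex_RInt_conv; [easy|easy|now apply Rbar_lt_of_le with t]. }
2:{ now apply sol_ex_RInt_conv. }
assert (0 <= RInt (fun s => w (t - s) * g s) 0 a).
{ apply RInt_ge_0; [easy| |].
  - apply sol_ex_RInt_conv; [easy|easy|now apply Rbar_lt_of_le with t].
  - intros s Hs. apply Rmult_le_pos; [apply (reg_w_nonneg _ _ _ _ reg)|].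
    apply Rlt_le, sol_g_pos. apply Rbar_lt_of_le with t; [lra|easy]. }
assert (c * RInt g a t <= RInt (fun s => w (t - s) * g s) a t).
{ rewrite <- RInt_scal_R by now apply sol_ex_RInt_g.
  apply RInt_le; [easy|apply ex_RInt_scal_R; now apply sol_ex_RInt_g|now apply sol_ex_RInt_conv|].
  intros s Hs. apply Rmult_le_compat_r.
  - apply Rlt_le, sol_g_pos. apply Rbar_lt_of_le with t; [lra|easy].
  - apply Hc. lra. }
lra.
Qed.

Lemma sol_conv_nonneg (t : R) : 0 <= t -> Rbar_lt t S -> 0 <= conv w g t.
Proof.
intros Ht HtS. rewrite <- (Rmult_0_l (RInt g 0 t)). apply sol_conv_ge; [lra|easy|].
intros u _. apply (reg_w_nonneg _ _ _ _ reg).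
Qed.

Lemma sol_increasing (s t : R) : 0 <= s <= t -> Rbar_lt t S -> x s <= x t.
Proof.
intros Hst Ht. apply le_of_derive_nonneg with (conv w g).
- apply Hst.
- intros r Hr. apply (reg_x_cont _ _ _ _ reg). now apply Rbar_lt_of_le with t.
- intros r Hr. apply (reg_x_eq _ _ _ _ reg); [lra|]. apply Rbar_lt_of_le with t; [lra|easy].
- intros r Hr. apply sol_conv_nonneg; [lra|]. apply Rbar_lt_of_le with t; [lra|easy].
Qed.

End Solution.

(** * Derivative rules and the energy argument *)

Lemma is_derive_minus_R (g h : R -> R) (t a b : R) :
  is_derive g t a -> is_derive h t b -> is_derive (fun s => g s - h s) t (a - b).
Proof. exact (is_derive_minus g h t a b). Qed.

Lemma is_derive_scal_R (h : R -> R) (t c a : R) :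
  is_derive h t a -> is_derive (fun s => c * h s) t (c * a).
Proof. exact (is_derive_scal h t c a). Qed.

Lemma is_derive_mult_R (g h : R -> R) (t a b : R) :
  is_derive g t a -> is_derive h t b -> is_derive (fun s => g s * h s) t (a * h t + g t * b).
Proof. intros Hg Hh. exact (is_derive_mult g h t a b Hg Hh Rmult_comm). Qed.

Lemma is_derive_comp_R (g h : R -> R) (t a b : R) :
  is_derive g (h t) a -> is_derive h t b -> is_derive (fun s => g (h s)) t (b * a).
Proof. exact (is_derive_comp g h t a b). Qed.

Lemma is_derive_linear (c a t : R) : is_derive (fun s => c * (s - a)) t c.
Proof. auto_derive; [easy|ring]. Qed.

Section NoGlobal.

Variables (f : R -> R) (eta : R).
Hypothesis f_cont : forall u, 0 < u -> continuous f u.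
Hypothesis f_pos : forall u, 0 < u -> 0 < f u.
Hypothesis f_infty : filterlim f (Rbar_locally p_infty) (Rbar_locally p_infty).
Hypothesis f_int0 : forall u, 0 < u -> ex_RInt_gen f (at_right 0) (at_point u).
Hypothesis eta_pos : 0 < eta.
Hypothesis FB_int :
  ex_RInt_gen (fun u => / sqrt (prim f u)) (at_point eta) (Rbar_locally p_infty).

Lemma inv_sqrt_prim_pos (u : R) : 0 < u -> 0 < / sqrt (prim f u).
Proof.
intros Hu. apply Rinv_0_lt_compat, sqrt_lt_R0. now apply prim_pos.
Qed.

Lemma is_derive_F_B (u : R) : 0 < u -> is_derive (F_B f) u (- / sqrt (prim f u)).
Proof.
intros Hu. apply (is_derive_tail (fun u => / sqrt (prim f u)) eta); try easy.
now apply continuous_inv_sqrt_prim.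
Qed.

Lemma F_B_nonneg (u : R) : 0 < u -> 0 <= F_B f u.
Proof.
apply (tail_nonneg (fun u => / sqrt (prim f u)) eta); try easy.
- now apply continuous_inv_sqrt_prim.
- apply inv_sqrt_prim_pos.
Qed.

Lemma filterlim_F_B : filterlim (F_B f) (Rbar_locally p_infty) (locally 0).
Proof.
apply (filterlim_tail (fun u => / sqrt (prim f u)) eta); try easy.
now apply continuous_inv_sqrt_prim.
Qed.

(* The energy [p^2/2 - k * prim f z] is nondecreasing, so that eventually [p >= sqrt (k * prim f z)],
   and [F_B f z] decreases at least linearly although it is nonnegative. *)
Lemma no_global_supersolution (z p q : R -> R) (a k : R) :
  0 < k -> 0 < z a ->
  (forall t, a <= t -> is_derive z t (p t)) ->
  (forall t, a <= t -> is_derive p t (q t)) ->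
  (forall t, a <= t -> 0 <= p t) ->
  (forall t, a <= t -> k * f (z t) <= q t) ->
  False.
Proof.
intros Hk Hza Hz Hp Hp0 Hq.
assert (zc : forall t, a <= t -> continuous z t).
{ intros t Ht. eapply is_derive_continuous. now apply Hz. }
assert (pc : forall t, a <= t -> continuous p t).
{ intros t Ht. eapply is_derive_continuous. now apply Hp. }
assert (zge : forall t, a <= t -> z a <= z t).
{ intros t Ht. apply le_of_derive_nonneg with p; [exact Ht| | |].
  - intros s Hs. now apply zc.
  - intros s Hs. apply Hz. lra.
  - intros s Hs. apply Hp0. lra. }
destruct (lower_bound_pos f f_cont f_pos f_infty (z a) Hza) as [m [Hm Hfm]].
assert (Hkm : 0 < k * m) by (now apply Rmult_lt_0_compat).
assert (Hqm : forall t, a <= t -> k * m <= q t).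
{ intros t Ht. eapply Rle_trans; [|now apply Hq].
  apply Rmult_le_compat_l; [lra|]. apply Hfm. now apply zge. }
assert (pge : forall t, a <= t -> k * m * (t - a) <= p t).
{ intros t Ht.
  assert (H := le_of_derive_nonneg (fun s => p s - k * m * (s - a)) (fun s => q s - k * m) a t Ht).
  cbv beta in H. specialize (Hp0 a (Rle_refl a)).
  assert (p a - k * m * (a - a) <= p t - k * m * (t - a)); [|lra].
  apply H.
  - intros s Hs. eapply is_derive_continuous.
    apply is_derive_minus_R; [now apply Hp|apply is_derive_linear].
  - intros s Hs. apply is_derive_minus_R; [apply Hp; lra|apply is_derive_linear].
  - intros s Hs. specialize (Hqm s ltac:(lra)). lra. }
(* After one unit of time the speed [p] is at least [k * m], so [z] grows linearly from [a + 1]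
   on. *)
assert (zbig : forall t, a + 1 <= t -> k * m * (t - (a + 1)) + z a <= z t).
{ intros t Ht.
  assert (H := le_of_derive_nonneg (fun s => z s - k * m * (s - (a + 1))) (fun s => p s - k * m) (a + 1) t Ht).
  cbv beta in H. assert (H1 := zge (a + 1) ltac:(lra)).
  assert (z (a + 1) - k * m * (a + 1 - (a + 1)) <= z t - k * m * (t - (a + 1))); [|lra].
  apply H.
  - intros s Hs. eapply is_derive_continuous.
    apply is_derive_minus_R; [apply Hz; lra|apply is_derive_linear].
  - intros s Hs. apply is_derive_minus_R; [apply Hz; lra|apply is_derive_linear].
  - intros s Hs. specialize (pge s ltac:(lra)).
    assert (k * m * 1 <= k * m * (s - a)) by (apply Rmult_le_compat_l; lra). lra. }
set (F0 := prim f (z a)).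
assert (HF0 : 0 < F0) by now apply prim_pos.
assert (Fbig : forall t, a <= t -> F0 + m * (z t - z a) <= prim f (z t)).
{ intros t Ht. specialize (zge t Ht).
  rewrite (prim_Chasles f f_cont f_int0 (z a) (z t)) by lra. fold F0.
  apply Rplus_le_compat_l, RInt_ge_const; [exact zge| |]; intros u Hu;
    [apply f_cont|apply Hfm]; lra. }
assert (energy : forall t, a <= t -> k * (prim f (z t) - F0) <= p t * p t / 2).
{ intros t Ht.
  assert (Hd : forall s, a <= s -> is_derive (fun s => / 2 * (p s * p s) - k * prim f (z s)) s
    (/ 2 * (q s * p s + p s * q s) - k * (p s * f (z s)))).
  { intros s Hs. apply is_derive_minus_R; apply is_derive_scal_R.
    - apply is_derive_mult_R; now apply Hp.
    - apply is_derive_comp_R; [|now apply Hz]. apply is_derive_prim; try easy.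
      specialize (zge s Hs). lra. }
  assert (H := le_of_derive_nonneg _ _ a t Ht (fun s Hs => is_derive_continuous _ _ _ (Hd s (proj1 Hs)))
    (fun s Hs => Hd s (Rlt_le _ _ (proj1 Hs)))).
  cbv beta in H. fold F0 in H.
  assert (0 <= p a * p a) by (apply Rmult_le_pos; apply Hp0; lra).
  assert (/ 2 * (p a * p a) - k * F0 <= / 2 * (p t * p t) - k * prim f (z t)); [|lra].
  apply H. intros s Hs.
  assert (0 <= p s * (q s - k * f (z s))).
  { apply Rmult_le_pos; [apply Hp0; lra|]. specialize (Hq s ltac:(lra)). lra. }
  lra. }
(* At this time linear growth has raised [prim f z] to at least [2 * F0]. From then on the initial
   energy costs at most half: p^2 >= 2 k (F - F0) >= k F, with F for [prim f (z t)]. *)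
set (b := a + 1 + F0 / (k * m * m)).
assert (Hb : a + 1 <= b).
{ assert (0 < F0 / (k * m * m)); [|unfold b; lra].
  apply Rdiv_lt_0_compat; [exact HF0|]. now apply Rmult_lt_0_compat. }
assert (F2 : forall t, b <= t -> 2 * F0 <= prim f (z t)).
{ intros t Ht. eapply Rle_trans; [|apply Fbig; lra].
  assert (m * (k * m * (b - (a + 1))) <= m * (z t - z a)).
  { apply Rmult_le_compat_l; [lra|]. specialize (zbig t ltac:(lra)).
    assert (k * m * (b - (a + 1)) <= k * m * (t - (a + 1))) by (apply Rmult_le_compat_l; lra).
    lra. }
  assert (m * (k * m * (b - (a + 1))) = F0) by (unfold b; field; lra).
  lra. }
assert (rate : forall t, b <= t -> sqrt k <= p t * / sqrt (prim f (z t))).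
{ intros t Ht. assert (Hzt := zge t ltac:(lra)).
  assert (HF : 0 < sqrt (prim f (z t))) by (apply sqrt_lt_R0, prim_pos; auto; lra).
  apply Rle_div_r; [exact HF|].
  rewrite <- sqrt_mult by (try apply Rlt_le, prim_pos; auto; lra).
  rewrite <- (sqrt_square (p t)) by (apply Hp0; lra).
  apply sqrt_le_1_alt. specialize (energy t ltac:(lra)). specialize (F2 t Ht).
  assert (k * (2 * F0) <= k * prim f (z t)) by (apply Rmult_le_compat_l; lra).
  lra. }
assert (Hsk : 0 < sqrt k) by now apply sqrt_lt_R0.
(* By this time a decrease at rate [sqrt k] has used up [F_B f (z b)] and one unit more, so
   [F_B f (z t)] would be at most -1. *)
set (t := b + (F_B f (z b) + 1) / sqrt k).
assert (HFb : 0 <= F_B f (z b)).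
{ apply F_B_nonneg. specialize (zge b ltac:(lra)). lra. }
assert (Ht : b <= t).
{ assert (0 < (F_B f (z b) + 1) / sqrt k); [|unfold t; lra]. apply Rdiv_lt_0_compat; lra. }
assert (Hd : forall s, b <= s -> is_derive (fun s => - sqrt k * (s - b) - F_B f (z s)) s
  (- sqrt k - p s * (- / sqrt (prim f (z s))))).
{ intros s Hs. apply is_derive_minus_R; [apply is_derive_linear|].
  apply is_derive_comp_R; [|apply Hz; lra]. apply is_derive_F_B.
  specialize (zge s ltac:(lra)). lra. }
assert (H := le_of_derive_nonneg _ _ b t Ht (fun s Hs => is_derive_continuous _ _ _ (Hd s (proj1 Hs)))
    (fun s Hs => Hd s (Rlt_le _ _ (proj1 Hs)))).
cbv beta in H.
assert (H1 : - sqrt k * (b - b) - F_B f (z b) <= - sqrt k * (t - b) - F_B f (z t)).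
{ apply H. intros s Hs. specialize (rate s ltac:(lra)). lra. }
assert (H2 : 0 <= F_B f (z t)).
{ apply F_B_nonneg. specialize (zge t ltac:(lra)). lra. }
assert (H3 : sqrt k * (t - b) = F_B f (z b) + 1) by (unfold t; field; lra).
lra.
Qed.

End NoGlobal.

(** * Rate at a finite blow-up time *)

Section BlowupRate.

Variables (w f x : R -> R) (T eta : R).
Hypothesis reg : regular_solution w f x (Finite T).
Hypothesis T_pos : 0 < T.
Hypothesis w0_pos : 0 < w 0.
Hypothesis x_blowup : filterlim x (at_left T) (Rbar_locally p_infty).
Hypothesis f_int0 : forall u, 0 < u -> ex_RInt_gen f (at_right 0) (at_point u).
Hypothesis eta_pos : 0 < eta.
Hypothesis FB_int :
  ex_RInt_gen (fun u => / sqrt (prim f u)) (at_point eta) (Rbar_locally p_infty).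

Let g (s : R) : R := f (x s).
Let I (t : R) : R := RInt g 0 t.
Let D (t : R) : R := conv w g t.

Let f_cont := reg_f_cont _ _ _ _ reg.
Let f_pos := reg_f_pos _ _ _ _ reg.
Let w_cont := reg_w_cont _ _ _ _ reg.
Let x_cont : forall t : R, t < T -> continuous x t := reg_x_cont _ _ _ _ reg.
Let x_pos : forall t : R, t < T -> 0 < x t := reg_x_pos _ _ _ _ reg.
Let x_eq : forall t : R, 0 < t -> t < T -> is_derive x t (D t) := reg_x_eq _ _ _ _ reg.
Let g_pos : forall t : R, t < T -> 0 < g t := sol_g_pos _ _ _ _ reg.
Let ex_g : forall a b : R, a <= b -> b < T -> ex_RInt g a b := sol_ex_RInt_g _ _ _ _ reg.
Let I_nonneg : forall a b : R, a <= b -> b < T -> 0 <= RInt g a b :=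
  sol_RInt_g_nonneg _ _ _ _ reg.
Let I_Chasles : forall a b c : R, a <= b <= c -> c < T ->
  RInt g a b + RInt g b c = RInt g a c := sol_RInt_g_Chasles _ _ _ _ reg.

Lemma Rabs_conv_part_le (v : R -> R) (K a b t : R) :
  (forall u, continuous v u) -> 0 <= a <= b -> b <= t -> t < T ->
  (forall u, t - b <= u <= t - a -> Rabs (v u) <= K) ->
  Rabs (RInt (fun s => v (t - s) * g s) a b) <= K * RInt g a b.
Proof.
intros Hv Hab Hbt Ht HK. apply Rabs_RInt_mult_le; [easy| | | |].
- apply (sol_ex_RInt_conv _ _ _ _ reg); [easy|easy|simpl; lra].
- apply ex_g; lra.
- intros s Hs. apply HK. lra.
- intros s Hs. apply Rlt_le, g_pos. lra.
Qed.

(** On [[0, T]] the kernel is at most [Kw], so x' <= Kw I, and integrating with [I] nondecreasing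
    gives x(t) - x(0) <= Kw T I(t). Blow-up of [x] is thus passed on to [I]. *)
Lemma integral_unbounded (K : R) :
  exists a, 0 <= a < T /\ forall t, a < t < T -> K <= I t.
Proof.
destruct (continuous_bounded w 0 T) as [Kw [HKw Hwb]]; [now intros|].
destruct (at_left_elim _ _ (x_blowup (fun v => x 0 + Kw * K * T < v) (ex_intro _ _ (fun v Hv => Hv))))
  as [a [Ha Hxa]].
exists (Rmax a 0). split.
{ split; [apply Rmax_r|now apply Rmax_lub_lt]. }
intros t Ht. assert (H1 := Rmax_l a 0). assert (H2 := Rmax_r a 0).
specialize (Hxa t ltac:(lra)).
assert (HI := I_nonneg 0 t ltac:(lra) ltac:(lra)). fold (I t) in HI.
assert (H : Rabs (x t - x 0) <= Kw * I t * (t - 0)).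
{ apply Rabs_diff_le_of_derive with D; [lra| | |].
  - intros s Hs. apply x_cont. lra.
  - intros s Hs. apply x_eq; lra.
  - intros s Hs. apply Rle_trans with (Kw * I s).
    + apply (Rabs_conv_part_le w Kw 0 s s); [exact w_cont|lra|lra|lra|].
      intros u Hu. apply Hwb. lra.
    + apply Rmult_le_compat_l; [lra|]. unfold I.
      rewrite <- (I_Chasles 0 s t) by lra.
      assert (H := I_nonneg s t ltac:(lra) ltac:(lra)). lra. }
assert (Kw * I t * (t - 0) <= Kw * I t * T).
{ apply Rmult_le_compat_l; [apply Rmult_le_pos; lra|lra]. }
assert (H3 : Kw * T * K < Kw * T * I t).
{ assert (H' := Rle_abs (x t - x 0)). lra. }
apply Rmult_lt_reg_l in H3; [lra|]. now apply Rmult_lt_0_compat.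
Qed.

(** Split the integral at a time [b] close to [T]. After [b] all lags are short and [w] is near
    [w 0]; the error from before [b] is at most the fixed number [K * I b], negligible because [I]
    is unbounded. *)
Lemma derive_asymptotics (eps : R) : 0 < eps ->
  exists a, 0 <= a < T /\ forall t, a < t < T -> Rabs (D t - w 0 * I t) <= eps * I t.
Proof.
intros He. set (v := fun u => w u - w 0).
assert (v_cont : forall u, continuous v u).
{ intros u. apply (continuous_minus w (fun _ => w 0)); [apply w_cont|apply continuous_const]. }
destruct (continuous_bounded v 0 T) as [K [HK Hvb]]; [now intros|].
destruct (uniformly_continuous w 0 T (eps / 2)) as [d [Hd Hu]]; [now intros|lra|].
(* The first bound keeps lags after [b] strictly below [d], the second keeps [b] positive. *)
set (b := T - Rmin (d / 2) (T / 2)).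
assert (Hm1 := Rmin_l (d / 2) (T / 2)). assert (Hm2 := Rmin_r (d / 2) (T / 2)).
assert (Hm3 : 0 < Rmin (d / 2) (T / 2)) by (apply Rmin_pos; lra).
assert (Hb : 0 < b < T) by (unfold b; lra).
destruct (integral_unbounded (2 * K * I b / eps)) as [a [Ha HI]].
exists (Rmax a b). split.
{ split; [eapply Rle_trans; [|apply Rmax_l]; lra|apply Rmax_lub_lt; lra]. }
intros t Ht. assert (H1 := Rmax_l a b). assert (H2 := Rmax_r a b).
specialize (HI t ltac:(lra)).
assert (E : D t - w 0 * I t = RInt (fun s => v (t - s) * g s) 0 t).
{ unfold D, conv, I. rewrite <- RInt_scal_R by (apply ex_g; lra).
  rewrite RInt_diff_R.
  - apply RInt_ext. intros s _. unfold v. symmetry. apply Rmult_minus_distr_r.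
  - apply (sol_ex_RInt_conv _ _ _ _ reg); [easy|lra|simpl; lra].
  - apply ex_RInt_scal_R, ex_g; lra. }
rewrite E, <- (RInt_Chasles_R _ 0 b t).
2, 3: apply (sol_ex_RInt_conv _ _ _ _ reg); [easy|lra|simpl; lra].
eapply Rle_trans; [apply Rabs_triang|].
assert (E1 : Rabs (RInt (fun s => v (t - s) * g s) 0 b) <= K * I b).
{ apply Rabs_conv_part_le; [exact v_cont|lra|lra|lra|]. intros u Hu'. apply Hvb. lra. }
assert (E2 : Rabs (RInt (fun s => v (t - s) * g s) b t) <= eps / 2 * RInt g b t).
{ apply Rabs_conv_part_le; [exact v_cont|lra|lra|lra|]. intros u Hu'.
  apply Rlt_le, Hu; try lra. rewrite Rminus_0_r, Rabs_pos_eq by lra. unfold b in *. lra. }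
assert (E3 := I_Chasles 0 b t ltac:(lra) ltac:(lra)). fold (I b) (I t) in E3.
assert (E4 := I_nonneg 0 b ltac:(lra) ltac:(lra)). fold (I b) in E4.
assert (E5 : eps / 2 * RInt g b t <= eps / 2 * I t) by (apply Rmult_le_compat_l; lra).
apply Rle_div_l in HI; [|exact He]. lra.
Qed.

Lemma is_derive_I (t : R) : 0 < t < T -> is_derive I t (g t).
Proof. intros Ht. apply (sol_is_derive_RInt_g _ _ _ _ reg 0 t); simpl; lra. Qed.

Lemma is_derive_prim_sol (t : R) : 0 < t < T ->
  is_derive (fun t => prim f (x t)) t (D t * g t).
Proof.
intros Ht. apply (is_derive_comp_R (prim f) x); [|apply x_eq; lra].
apply (is_derive_prim f f_cont f_int0 (x t)). apply x_pos. lra.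
Qed.

(* Since [x' ~ w 0 * I] and [I' = f x], the derivatives of [prim f x] and of
   [w 0 * I^2 / 2] are equivalent; both functions tend to infinity. *)
Lemma prim_asymptotics (eps : R) : 0 < eps ->
  exists a, 0 <= a < T /\ forall t, a < t < T ->
    Rabs (prim f (x t) - w 0 / 2 * (I t * I t)) <= eps * (I t * I t).
Proof.
intros He. destruct (derive_asymptotics eps He) as [a [Ha HD]].
set (b := (a + T) / 2).
assert (Hb : a < b < T) by (unfold b; lra).
set (h := fun t => prim f (x t) - w 0 / 2 * (I t * I t)).
assert (Hh : forall t, 0 < t < T ->
  is_derive h t (D t * g t - w 0 / 2 * (g t * I t + I t * g t))).
{ intros t Ht. apply is_derive_minus_R; [now apply is_derive_prim_sol|].
  apply is_derive_scal_R, is_derive_mult_R; now apply is_derive_I. }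
assert (Hq : forall t, 0 < t < T ->
  is_derive (fun t => eps / 2 * (I t * I t)) t (eps / 2 * (g t * I t + I t * g t))).
{ intros t Ht. apply is_derive_scal_R, is_derive_mult_R; now apply is_derive_I. }
assert (Hdh : forall t, b < t < T ->
  Rabs (D t * g t - w 0 / 2 * (g t * I t + I t * g t)) <= eps / 2 * (g t * I t + I t * g t)).
{ intros t Ht. replace (D t * g t - w 0 / 2 * (g t * I t + I t * g t)) with ((D t - w 0 * I t) * g t) by field.
  replace (eps / 2 * (g t * I t + I t * g t)) with (eps * I t * g t) by field.
  assert (Hg := g_pos t ltac:(lra)).
  rewrite Rabs_mult, (Rabs_pos_eq (g t)) by lra.
  apply Rmult_le_compat_r; [lra|]. apply HD. lra. }
(* The bound [Hdh] says that [eps / 2 * I^2] plus or minus [h] is nondecreasing, so |h t| exceeds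
   [eps / 2 * I^2] by at most |h b|. *)
assert (Hlow : forall t, b < t < T -> h b + eps / 2 * (I b * I b) <= h t + eps / 2 * (I t * I t)).
{ intros t Ht.
  apply (le_of_derive_nonneg (fun t => h t + eps / 2 * (I t * I t))
    (fun t => D t * g t - w 0 / 2 * (g t * I t + I t * g t) + eps / 2 * (g t * I t + I t * g t)));
    [lra| | |]; intros s Hs.
  - apply (continuous_plus h); eapply is_derive_continuous; [apply Hh|apply Hq]; lra.
  - apply (is_derive_plus h); [apply Hh|apply Hq]; lra.
  - specialize (Hdh s ltac:(lra)). apply Rabs_le_between in Hdh. lra. }
assert (Hup : forall t, b < t < T -> eps / 2 * (I b * I b) - h b <= eps / 2 * (I t * I t) - h t).
{ intros t Ht.
  apply (le_of_derive_nonneg (fun t => eps / 2 * (I t * I t) - h t)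
    (fun t => eps / 2 * (g t * I t + I t * g t) - (D t * g t - w 0 / 2 * (g t * I t + I t * g t))));
    [lra| | |]; intros s Hs.
  - apply (continuous_minus _ h); eapply is_derive_continuous; [apply Hq|apply Hh]; lra.
  - apply is_derive_minus_R; [apply Hq|apply Hh]; lra.
  - specialize (Hdh s ltac:(lra)). apply Rabs_le_between in Hdh. lra. }
(* [eps / 2 * M] exceeds |h b|, and the summand 1 gives M >= 1, so that I >= M implies I^2 >= M. *)
set (M := 2 * Rabs (h b) / eps + 1).
assert (HM : 1 <= M).
{ assert (0 <= 2 * Rabs (h b) / eps); [|unfold M; lra].
  apply Rdiv_le_0_compat; [|exact He]. assert (H := Rabs_pos (h b)). lra. }
destruct (integral_unbounded M) as [c [Hc HI]].
exists (Rmax b c). split.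
{ split; [eapply Rle_trans; [|apply Rmax_l]; lra|apply Rmax_lub_lt; lra]. }
intros t Ht. assert (H1 := Rmax_l b c). assert (H2 := Rmax_r b c).
specialize (HI t ltac:(lra)). specialize (Hlow t ltac:(lra)). specialize (Hup t ltac:(lra)).
assert (H3 : Rabs (h b) <= eps / 2 * (I t * I t)).
{ apply Rle_trans with (eps / 2 * M).
  - unfold M. replace (eps / 2 * (2 * Rabs (h b) / eps + 1)) with (Rabs (h b) + eps / 2) by (field; lra). lra.
  - apply Rmult_le_compat_l; [lra|]. rewrite <- (Rmult_1_r M). apply Rmult_le_compat; lra. }
assert (H4 : 0 <= eps / 2 * (I b * I b)).
{ apply Rmult_le_pos; [lra|]. apply Rle_0_sqr. }
fold (h t). apply Rabs_le_between in H3. apply Rabs_le_between. lra.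
Qed.

(** The quotient is D / I divided by the square root of [prim f x] / I^2. Their limits [w 0] and
    sqrt(w(0) / 2) combine to sqrt(2 w(0)). *)
Lemma speed_asymptotics :
  filterlim (fun t => D t * / sqrt (prim f (x t))) (at_left T) (locally (sqrt (2 * w 0))).
Proof.
destruct (integral_unbounded 1) as [a [Ha HI1]].
assert (L1 : filterlim (fun t => D t / I t) (at_left T) (locally (w 0))).
{ apply filterlim_locally_intro; [apply at_left_proper_filter|]. intros eps He.
  destruct (derive_asymptotics (eps / 2)) as [b [Hb HD]]; [lra|].
  apply at_left_intro with (Rmax a b); [apply Rmax_lub_lt; lra|]. intros t Ht.
  assert (H1 := Rmax_l a b). assert (H2 := Rmax_r a b).
  specialize (HI1 t ltac:(lra)). specialize (HD t ltac:(lra)).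
  replace (D t / I t - w 0) with ((D t - w 0 * I t) / I t) by (field; lra).
  rewrite Rabs_div, (Rabs_pos_eq (I t)) by lra.
  apply Rle_lt_trans with (eps / 2); [|lra]. apply Rle_div_l; lra. }
assert (L2 : filterlim (fun t => prim f (x t) / (I t * I t)) (at_left T) (locally (w 0 / 2))).
{ apply filterlim_locally_intro; [apply at_left_proper_filter|]. intros eps He.
  destruct (prim_asymptotics (eps / 2)) as [b [Hb HD]]; [lra|].
  apply at_left_intro with (Rmax a b); [apply Rmax_lub_lt; lra|]. intros t Ht.
  assert (H1 := Rmax_l a b). assert (H2 := Rmax_r a b).
  specialize (HI1 t ltac:(lra)). specialize (HD t ltac:(lra)).
  assert (HII : 0 < I t * I t) by (apply Rmult_lt_0_compat; lra).
  replace (prim f (x t) / (I t * I t) - w 0 / 2)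
    with ((prim f (x t) - w 0 / 2 * (I t * I t)) / (I t * I t)) by (field; lra).
  rewrite Rabs_div, (Rabs_pos_eq (I t * I t)) by lra.
  apply Rle_lt_trans with (eps / 2); [|lra]. apply Rle_div_l; lra. }
assert (Hs0 : 0 < sqrt (w 0 / 2)) by (apply sqrt_lt_R0; lra).
assert (L3 : filterlim (fun t => / sqrt (prim f (x t) / (I t * I t))) (at_left T)
  (locally (/ sqrt (w 0 / 2)))).
{ apply (filterlim_comp _ _ _ (fun t => prim f (x t) / (I t * I t)) (fun v => / sqrt v) _ _ _ L2).
  apply (continuous_Rinv_comp (fun v => sqrt v)); [apply continuous_sqrt|lra]. }
assert (L := filterlim_mult_R _ _ _ _ _ _ L1 L3).
replace (sqrt (2 * w 0)) with (w 0 * / sqrt (w 0 / 2)).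
- eapply filterlim_ext_loc; [|exact L].
  apply at_left_intro with a; [lra|]. intros t Ht. specialize (HI1 t Ht). cbv beta.
  assert (HF : 0 < prim f (x t)) by (apply prim_pos; try assumption; apply x_pos; lra).
  rewrite sqrt_div_alt by (apply Rmult_lt_0_compat; lra).
  rewrite sqrt_square by lra. field. split; [|lra].
  apply Rgt_not_eq. now apply sqrt_lt_R0.
- apply Rmult_eq_reg_r with (sqrt (w 0 / 2)); [|lra].
  rewrite Rmult_assoc, Rinv_l, Rmult_1_r by lra.
  rewrite <- sqrt_mult by lra. replace (2 * w 0 * (w 0 / 2)) with (w 0 * w 0) by field.
  symmetry. apply sqrt_square. lra.
Qed.

(** With c the limiting speed, F_B(x(s)) + c (s - T) has derivative at most [eps / 2] in absolute
    value near [T]. Integrate from [t] to [r] and let [r] tend to [T], where the function vanishes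
    in the limit. *)
Lemma blowup_rate :
  filterlim (fun t => F_B f (x t) / (T - t)) (at_left T) (locally (sqrt (2 * w 0))).
Proof.
set (c := sqrt (2 * w 0)).
apply filterlim_locally_intro; [apply at_left_proper_filter|]. intros eps He.
destruct (at_left_elim _ _ (filterlim_locally_elim _ _ _ _ speed_asymptotics (eps / 2) ltac:(lra)))
  as [a [Ha Hs]]. fold c in Hs.
assert (LF : filterlim (fun t => F_B f (x t)) (at_left T) (locally 0)).
{ apply (filterlim_comp _ _ _ x (F_B f) _ _ _ x_blowup). now apply (filterlim_F_B f eta). }
apply at_left_intro with (Rmax a 0); [now apply Rmax_lub_lt|]. intros t Ht.
assert (H1 := Rmax_l a 0). assert (H2 := Rmax_r a 0).
assert (Hd : forall s, t <= s < T -> is_derive (fun s => F_B f (x s) + c * (s - T)) s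
  (D s * (- / sqrt (prim f (x s))) + c)).
{ intros s Hs'. apply (is_derive_plus (fun s => F_B f (x s)) (fun s => c * (s - T)));
    [|apply is_derive_linear].
  apply (is_derive_comp_R (F_B f) x); [|apply x_eq; lra]. apply is_derive_F_B with eta; try assumption.
  apply x_pos. lra. }
assert (Hr : forall r, t < r < T ->
  Rabs (F_B f (x r) + c * (r - T) - (F_B f (x t) + c * (t - T))) <= eps / 2 * (r - t)).
{ intros r Hr. apply (Rabs_diff_le_of_derive (fun s => F_B f (x s) + c * (s - T))
    (fun s => D s * (- / sqrt (prim f (x s))) + c)); [lra| | |]; intros s Hs'.
  - eapply is_derive_continuous, Hd. lra.
  - apply Hd. lra.
  - specialize (Hs s ltac:(lra)). rewrite Rabs_minus_sym in Hs.
    replace (D s * (- / sqrt (prim f (x s))) + c) with (c - D s * / sqrt (prim f (x s))) by ring. lra. }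
assert (Hlim : Rabs (F_B f (x t) - c * (T - t)) <= eps / 2 * (T - t)).
{ apply le_epsilon. intros e Hee.
  assert (Hc : 0 < c) by (apply sqrt_lt_R0; lra).
  destruct (at_left_elim _ _ (filterlim_locally_elim _ _ _ _ LF (e / 2) ltac:(lra))) as [b [Hb Hb']].
  (* A time past both [b] and [t] at which [F_B f (x r)] and [c * (T - r)] are each at most
     [e / 2]. *)
  set (r := Rmax (Rmax ((b + T) / 2) ((t + T) / 2)) (T - e / (2 * c))).
  assert (Hec : 0 < e / (2 * c)) by (apply Rdiv_lt_0_compat; lra).
  assert (R1 : (b + T) / 2 <= r) by (eapply Rle_trans; [apply Rmax_l|apply Rmax_l]).
  assert (R2 : (t + T) / 2 <= r) by (eapply Rle_trans; [apply Rmax_r|apply Rmax_l]).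
  assert (R3 : T - e / (2 * c) <= r) by apply Rmax_r.
  assert (R4 : r < T) by (repeat apply Rmax_lub_lt; lra).
  specialize (Hr r ltac:(lra)). specialize (Hb' r ltac:(lra)).
  rewrite Rminus_0_r in Hb'.
  assert (R5 : c * (T - r) <= e / 2).
  { apply Rle_trans with (c * (e / (2 * c))); [apply Rmult_le_compat_l; lra|]. right. field. lra. }
  assert (R6 : 0 <= c * (T - r)) by (apply Rmult_le_pos; lra).
  assert (R7 : eps / 2 * (r - t) <= eps / 2 * (T - t)) by (apply Rmult_le_compat_l; lra).
  apply Rabs_le_between in Hr. apply Rabs_lt_between in Hb'. apply Rabs_le_between. lra. }
replace (F_B f (x t) / (T - t) - c) with ((F_B f (x t) - c * (T - t)) / (T - t)) by (field; lra).
rewrite Rabs_div, (Rabs_pos_eq (T - t)) by lra.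
apply Rle_lt_trans with (eps / 2); [|lra]. apply Rle_div_l; lra.
Qed.

End BlowupRate.

(** * Absence of global solutions *)

Section GlobalSolution.

Variables (w f x : R -> R) (eta c d : R).
Hypothesis reg : regular_solution w f x p_infty.
Hypothesis c_pos : 0 < c.
Hypothesis d_pos : 0 < d.
Hypothesis w_lower : forall u, 0 <= u <= d -> c <= w u.
Hypothesis f_superlinear :
  filterlim (fun u => f u / u) (Rbar_locally p_infty) (Rbar_locally p_infty).

Let g (s : R) : R := f (x s).
Let J (t : R) : R := RInt g 0 t.

Let f_cont := reg_f_cont _ _ _ _ reg.
Let f_pos := reg_f_pos _ _ _ _ reg.
Let x_cont : forall t : R, continuous x t := fun t => reg_x_cont _ _ _ _ reg t I.
Let x_pos : forall t : R, 0 < x t := fun t => reg_x_pos _ _ _ _ reg t I.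
Let x_eq : forall t : R, 0 < t -> is_derive x t (conv w g t) :=
  fun t Ht => reg_x_eq _ _ _ _ reg t Ht I.
Let g_cont : forall t : R, continuous g t := fun t => sol_g_cont _ _ _ _ reg t I.
Let g_pos : forall t : R, 0 < g t := fun t => sol_g_pos _ _ _ _ reg t I.
Let x_incr : forall s t : R, 0 <= s <= t -> x s <= x t :=
  fun s t Hst => sol_increasing _ _ _ _ reg s t Hst I.

Lemma superlinear_infty : filterlim f (Rbar_locally p_infty) (Rbar_locally p_infty).
Proof.
intros P [M HM].
destruct (f_superlinear (fun v => 1 < v)) as [N HN]; [now exists 1|].
exists (Rmax N (Rmax M 0)). intros u Hu. apply HM.
assert (H1 := Rmax_l N (Rmax M 0)). assert (H2 := Rmax_r N (Rmax M 0)).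
assert (H3 := Rmax_l M 0). assert (H4 := Rmax_r M 0).
specialize (HN u ltac:(lra)). apply Rlt_div_r in HN; lra.
Qed.

Lemma conv_ge_window (h m t : R) :
  0 < h <= d -> h <= t -> (forall s, t - h <= s <= t -> m <= g s) ->
  c * (m * h) <= conv w g t.
Proof.
intros Hh Ht Hm. apply Rle_trans with (c * RInt g (t - h) t).
- apply Rmult_le_compat_l; [lra|].
  replace (m * h) with (m * (t - (t - h))) by ring.
  apply RInt_ge_const; [lra|now intros|exact Hm].
- apply (sol_conv_ge _ _ _ _ reg); [lra|exact I|]. intros u Hu. apply w_lower. lra.
Qed.

(** Since [x] stays above [x 0], [f x] has a positive lower bound [m]; from time [d] on a full
    window fits, and x' >= c m d forces linear growth. *)
Lemma global_unbounded (K : R) : exists a, 0 <= a /\ forall t, a <= t -> K <= x t.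
Proof.
destruct (lower_bound_pos f f_cont f_pos superlinear_infty (x 0) (x_pos 0)) as [m [Hm Hfm]].
set (k := c * (m * d)).
assert (Hk : 0 < k) by (repeat apply Rmult_lt_0_compat; lra).
exists (d + Rmax K 0 / k).
assert (H1 := Rmax_l K 0). assert (H2 := Rmax_r K 0).
assert (H3 : 0 <= Rmax K 0 / k) by (apply Rdiv_le_0_compat; lra).
split; [lra|]. intros t Ht.
assert (Hd : forall s, 0 < s -> is_derive (fun s => x s - k * (s - d)) s (conv w g s - k)).
{ intros s Hs. apply is_derive_minus_R; [now apply x_eq|apply is_derive_linear]. }
assert (x d - k * (d - d) <= x t - k * (t - d)).
{ apply (le_of_derive_nonneg (fun s => x s - k * (s - d)) (fun s => conv w g s - k));
    [lra| | |]; intros s Hs.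
  - eapply is_derive_continuous, Hd. lra.
  - apply Hd. lra.
  - assert (k <= conv w g s); [|lra].
    apply conv_ge_window; [lra|lra|]. intros r Hr. apply Hfm, x_incr. lra. }
assert (Hxd := x_pos d).
assert (k * (Rmax K 0 / k) <= k * (t - d)) by (apply Rmult_le_compat_l; lra).
replace (k * (Rmax K 0 / k)) with (Rmax K 0) in * by (field; lra).
lra.
Qed.

Lemma global_superlinear (K : R) :
  exists a, 0 <= a /\ forall t, a <= t -> K * x t <= g t.
Proof.
destruct (f_superlinear (fun v => K < v)) as [N HN]; [now exists K|].
destruct (global_unbounded (N + 1)) as [a [Ha Hx]].
exists a. split; [exact Ha|]. intros t Ht. specialize (Hx t Ht).
specialize (HN (x t) ltac:(lra)). apply Rlt_div_r in HN; [|apply x_pos]. unfold g. lra.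
Qed.

(* If [f u >= K u] for large [u], two integrations over windows of length [h]
   give [x t >= c K h^2 x (t - 2 h)], with [K] arbitrary. *)
Lemma global_superexp : superexp_growth x.
Proof.
split; [intros t _; split; [apply x_cont|apply x_pos]|split].
- intros P [M HM]. destruct (global_unbounded (M + 1)) as [a [Ha Hx]].
  exists a. intros t Ht. apply HM. specialize (Hx t ltac:(lra)). lra.
- intros eps He. apply filterlim_locally_intro; [apply Rbar_locally_filter|].
  intros e Hee. set (h := Rmin eps d / 2).
  assert (Hm1 := Rmin_l eps d). assert (Hm2 := Rmin_r eps d).
  assert (Hm3 : 0 < Rmin eps d) by (apply Rmin_pos; lra).
  assert (Hh : 0 < h) by (unfold h; lra).
  assert (Hch : 0 < c * h * h) by (repeat apply Rmult_lt_0_compat; lra).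
  (* Makes c K h^2 equal to 2 / e, so the ratio x(t - eps) / x(t) is at most e / 2. *)
  set (K := 2 / (c * h * h * e)).
  assert (HK : 0 < K) by (apply Rdiv_lt_0_compat; [lra|now apply Rmult_lt_0_compat]).
  destruct (global_superlinear K) as [a [Ha Hg]].
  exists (a + 2 * h + eps). intros t Ht.
  assert (Hxt := x_pos t). assert (Hxe := x_pos (t - eps)).
  assert (H1 : forall r, t - h <= r <= t -> c * (K * x (t - 2 * h) * h) <= conv w g r).
  { intros r Hr. apply conv_ge_window; [unfold h in *; lra|lra|]. intros s Hs.
    apply Rle_trans with (K * x s); [|apply Hg; lra].
    apply Rmult_le_compat_l; [lra|]. apply x_incr. lra. }
  assert (H2 : c * (K * x (t - 2 * h) * h) * h <= x t - x (t - h)).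
  { destruct (mean_value x (conv w g) (t - h) t) as [r [Hr E]].
    - lra.
    - intros s _. apply x_cont.
    - intros s Hs. apply x_eq. lra.
    - rewrite E. replace (t - (t - h)) with h by ring.
      apply Rmult_le_compat_r; [lra|]. apply H1. lra. }
  assert (H3 : x (t - eps) <= x (t - 2 * h)) by (apply x_incr; unfold h in *; lra).
  assert (H4 := x_pos (t - h)).
  assert (H5 : c * h * h * K * x (t - eps) <= c * h * h * K * x (t - 2 * h)).
  { apply Rmult_le_compat_l; [|exact H3]. apply Rmult_le_pos; lra. }
  assert (H6 : c * h * h * K = 2 / e) by (unfold K; field; lra).
  rewrite H6 in H5.
  assert (H7 : 2 / e * x (t - eps) <= x t).
  { eapply Rle_trans; [exact H5|]. rewrite <- H6. lra. }
  rewrite Rminus_0_r, Rabs_pos_eq by (apply Rlt_le, Rdiv_lt_0_compat; lra).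
  apply Rlt_div_l; [exact Hxt|].
  apply Rlt_le_trans with (e * (2 / e * x (t - eps))).
  + replace (e * (2 / e * x (t - eps))) with (2 * x (t - eps)) by (field; lra). lra.
  + apply Rmult_le_compat_l; lra.
Qed.

Lemma is_derive_J (t : R) : is_derive J t (g t).
Proof. now apply is_derive_RInt_everywhere. Qed.

Lemma J_unbounded (K : R) : exists a, 0 <= a /\ forall t, a <= t -> K <= J t.
Proof.
destruct (lower_bound_pos f f_cont f_pos superlinear_infty (x 0) (x_pos 0)) as [m [Hm Hfm]].
assert (H1 := Rmax_l K 0). assert (H2 := Rmax_r K 0).
exists (Rmax K 0 / m). assert (H3 : 0 <= Rmax K 0 / m) by (apply Rdiv_le_0_compat; lra).
split; [exact H3|]. intros t Ht.
assert (m * (t - 0) <= J t).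
{ apply RInt_ge_const; [lra|now intros|]. intros s Hs. apply Hfm, x_incr. lra. }
assert (m * (Rmax K 0 / m) <= m * t) by (apply Rmult_le_compat_l; lra).
replace (m * (Rmax K 0 / m)) with (Rmax K 0) in * by (field; lra). lra.
Qed.

Hypothesis f_pres : preserves_superexp f.

(** Superexponential growth of [x] is preserved by [f], so g(t - d) <= g(t) / 4 eventually.
    Integrating gives J(t - d) <= J(t) / 4 plus a constant, which a large J(t) absorbs into another
    quarter. At least half of J(t) then comes from the window of length [d] where w >= c. *)
Lemma window_dominates : exists a, d <= a /\ forall t, a <= t -> c / 2 * J t <= conv w g t.
Proof.
destruct (filterlim_locally_elim _ _ _ _ (f_pres x global_superexp d d_pos) (1 / 4) ltac:(lra))
  as [N HN].
set (b := Rmax d (N + 1)).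
assert (Hb1 : d <= b) by apply Rmax_l. assert (Hb2 : N + 1 <= b) by apply Rmax_r.
assert (Hg : forall t, b <= t -> g (t - d) <= 1 / 4 * g t).
{ intros t Ht. specialize (HN t ltac:(lra)). 
  change (Rabs (g (t - d) / g t - 0) < 1 / 4) in HN.
  assert (H1 := g_pos t). assert (H2 := g_pos (t - d)).
  rewrite Rminus_0_r, Rabs_pos_eq in HN by (apply Rlt_le, Rdiv_lt_0_compat; lra).
  apply (Rmult_lt_compat_r (g t)) in HN; [|exact H1].
  replace (g (t - d) / g t * g t) with (g (t - d)) in HN by (field; lra). lra. }
destruct (J_unbounded (4 * J (b - d))) as [a [Ha HJ]].
exists (Rmax a b). split; [eapply Rle_trans; [exact Hb1|apply Rmax_r]|].
intros t Ht. assert (H1 := Rmax_l a b). assert (H2 := Rmax_r a b).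
specialize (HJ t ltac:(lra)).
assert (Hshift : forall s, is_derive (fun s => J (s - d)) s (g (s - d))).
{ intros s. replace (g (s - d)) with (1 * g (s - d)) by ring.
  apply (is_derive_comp_R J (fun s => s - d)); [apply is_derive_J|].
  auto_derive; [easy|ring]. }
assert (Hd : forall s, is_derive (fun s => 1 / 4 * J s - J (s - d)) s (1 / 4 * g s - g (s - d))).
{ intros s. apply is_derive_minus_R; [|apply Hshift].
  apply is_derive_scal_R, is_derive_J. }
assert (H3 : 1 / 4 * J b - J (b - d) <= 1 / 4 * J t - J (t - d)).
{ apply (le_of_derive_nonneg (fun s => 1 / 4 * J s - J (s - d))
    (fun s => 1 / 4 * g s - g (s - d))); [lra| | |]; intros s Hs.
  - eapply is_derive_continuous, Hd.
  - apply Hd.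
  - specialize (Hg s ltac:(lra)). lra. }
assert (H4 : 0 <= J b) by (apply (sol_RInt_g_nonneg _ _ _ _ reg); [lra|exact I]).
assert (H5 : J (t - d) + RInt g (t - d) t = J t).
{ apply (sol_RInt_g_Chasles _ _ _ _ reg); [lra|exact I]. }
apply Rle_trans with (c * RInt g (t - d) t).
- replace (c / 2 * J t) with (c * (1 / 2 * J t)) by field.
  apply Rmult_le_compat_l; lra.
- apply (sol_conv_ge _ _ _ _ reg); [lra|exact I|]. intros u Hu. apply w_lower. lra.
Qed.

Hypothesis f_asymp : asymp_increasing f.
Hypothesis f_int0 : forall u, 0 < u -> ex_RInt_gen f (at_right 0) (at_point u).
Hypothesis eta_pos : 0 < eta.
Hypothesis FB_int :
  ex_RInt_gen (fun u => / sqrt (prim f u)) (at_point eta) (Rbar_locally p_infty).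

(* With [phi] increasing and [phi ~ f], the double primitive [z] of a multiple of [phi (x t)]
   lies below [x], so [z'' >= const * phi (x t) >= const * phi (z t)]. *)
Lemma no_global_solution : False.
Proof.
destruct f_asymp as [phi [Hphi [phi_incr Hlim]]].
destruct (filterlim_locally_elim _ _ _ _ Hlim (1 / 2) ltac:(lra)) as [N HN].
set (A := Rmax N 0 + 1).
assert (HA1 : N < A) by (assert (H := Rmax_l N 0); unfold A; lra).
assert (HA2 : 0 < A) by (assert (H := Rmax_r N 0); unfold A; lra).
assert (Hf : forall u, A <= u -> phi u <= 2 * f u /\ f u <= 2 * phi u).
{ intros u Hu. specialize (HN u ltac:(lra)). cbv beta in HN.
  destruct (Hphi u ltac:(lra)) as [_ Hp].
  assert (E : f u = f u / phi u * phi u) by (field; lra).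
  apply Rabs_lt_between in HN.
  assert (1 / 2 * phi u <= f u / phi u * phi u) by (apply Rmult_le_compat_r; lra).
  assert (f u / phi u * phi u <= 2 * phi u) by (apply Rmult_le_compat_r; lra).
  lra. }
destruct window_dominates as [a1 [Ha1 Hwin]].
destruct (global_unbounded A) as [a2 [Ha2 HxA]].
set (a := Rmax a1 a2).
assert (Haa1 : a1 <= a) by apply Rmax_l. assert (Haa2 : a2 <= a) by apply Rmax_r.
assert (phi_cont : forall t, continuous (fun t => phi (x t)) t).
{ intros t. apply (continuous_comp x phi); [apply x_cont|]. apply Hphi, x_pos. }
(* As phi <= 2 f along [x], the factor c / 4 makes p <= (c / 2) J <= x', hence z <= x. Conversely f
   <= 2 phi at [z] turns the lower bound (c / 4) phi(z) for [q] into (c / 8) f(z). *)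
set (p := fun t => c / 4 * RInt (fun t => phi (x t)) a t).
set (q := fun t => c / 4 * phi (x t)).
set (z := fun t => x a + RInt p a t).
assert (Hp : forall t, is_derive p t (q t)).
{ intros t. apply is_derive_scal_R. now apply (is_derive_RInt_everywhere (fun t => phi (x t))). }
assert (p_cont : forall t, continuous p t).
{ intros t. eapply is_derive_continuous, Hp. }
assert (Hz : forall t, is_derive z t (p t)).
{ intros t. replace (p t) with (0 + p t) by ring.
  apply (is_derive_plus (fun _ => x a)).
  - exact (is_derive_const (K := R_AbsRing) (V := R_NormedModule) (x a) t).
  - now apply is_derive_RInt_everywhere. }
assert (za : z a = x a).
{ unfold z. rewrite RInt_point. apply Rplus_0_r. }
assert (Hp0 : forall t, a <= t -> 0 <= p t).
{ intros t Ht. apply Rmult_le_pos; [lra|]. apply RInt_nonneg; [exact Ht|now intros|].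
  intros s _. apply Rlt_le, Hphi, x_pos. }
assert (zge : forall t, a <= t -> x a <= z t).
{ intros t Ht. rewrite <- za. apply le_of_derive_nonneg with p; [exact Ht| | |]; intros s Hs.
  - eapply is_derive_continuous, Hz.
  - apply Hz.
  - apply Hp0. lra. }
assert (zle : forall t, a <= t -> z t <= x t).
{ intros t Ht.
  assert (x a - z a <= x t - z t); [|lra].
  apply (le_of_derive_nonneg (fun t => x t - z t) (fun t => conv w g t - p t)); [exact Ht| | |];
    intros s Hs.
  - apply (continuous_minus x); [apply x_cont|]. eapply is_derive_continuous, Hz.
  - apply is_derive_minus_R; [apply x_eq; lra|apply Hz].
  - assert (p s <= conv w g s); [|lra].
    eapply Rle_trans; [|apply Hwin; lra].
    assert (H1 : J a + RInt g a s = J s).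
    { apply (sol_RInt_g_Chasles _ _ _ _ reg); [lra|exact I]. }
    assert (H2 : 0 <= J a) by (apply (sol_RInt_g_nonneg _ _ _ _ reg); [lra|exact I]).
    assert (H3 : RInt (fun t => phi (x t)) a s <= 2 * RInt g a s).
    { rewrite <- RInt_scal_R by (now apply ex_RInt_of_continuous_everywhere).
      apply RInt_le; [lra|now apply ex_RInt_of_continuous_everywhere| |].
      - apply ex_RInt_scal_R. now apply ex_RInt_of_continuous_everywhere.
      - intros r Hr. apply Hf, HxA. lra. }
    unfold p. replace (c / 2 * J s) with (c / 4 * (2 * J s)) by field.
    apply Rmult_le_compat_l; lra. }
apply (no_global_supersolution f eta f_cont f_pos superlinear_infty f_int0 eta_pos FB_int
  z p q a (c / 8)).
- lra.
- rewrite za. apply x_pos.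
- intros t _. apply Hz.
- intros t _. apply Hp.
- exact Hp0.
- intros t Ht. specialize (zge t Ht). specialize (zle t Ht).
  assert (HxaA : A <= x a) by (apply HxA; lra).
  destruct (Hf (z t) ltac:(lra)) as [_ H1].
  assert (H2 : phi (z t) <= phi (x t)).
  { destruct zle as [zlt|E]; [apply Rlt_le, phi_incr; lra|rewrite E; lra]. }
  unfold q. replace (c / 4 * phi (x t)) with (c / 8 * (2 * phi (x t))) by field.
  apply Rmult_le_compat_l; lra.
Qed.

End GlobalSolution.

(** * Maximal solutions *)

Section BoundedSolution.

Variables (w f x : R -> R) (T : R).
Hypothesis reg : regular_solution w f x (Finite T).
Hypothesis T_pos : 0 < T.

(** By monotonicity [x] tends to its supremum [L] at [T], so the extension by the constant [L] is
    continuous and can be fed to [continuation_step]. *)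
Lemma bounded_solution_extends (K : R) :
  (forall t, 0 <= t < T -> x t <= K) ->
  exists (y : R -> R) (d : R), 0 < d /\
    (forall t, continuous y t) /\
    (forall t, 0 <= t < T -> y t = x t) /\
    (forall t, 0 <= t < T + d -> 0 < y t) /\
    (forall t, 0 < t < T + d -> is_derive y t (conv w (fun s => f (y s)) t)).
Proof.
intros HK.
assert (x_incr : forall s t, 0 <= s <= t -> t < T -> x s <= x t).
{ intros s t. exact (sol_increasing _ _ _ _ reg s t). }
destruct (completeness (fun v => exists t, 0 <= t < T /\ v = x t)) as [L [Lub Llub]].
{ exists K. intros v [t [Ht ->]]. now apply HK. }
{ exists (x 0). exists 0. split; [lra|reflexivity]. }
assert (xL : forall t, 0 <= t < T -> x t <= L).
{ intros t Ht. apply Lub. now exists t. }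
assert (x0 : 0 < x 0) by (apply (reg_x_pos _ _ _ _ reg); exact T_pos).
assert (x0L : x 0 <= L) by (apply xL; lra).
set (X := fun t => if Rlt_dec t T then x t else L).
assert (Xx : forall t, t < T -> X t = x t).
{ intros t Ht. unfold X. destruct Rlt_dec; [reflexivity|lra]. }
assert (XL : forall t, T <= t -> X t = L).
{ intros t Ht. unfold X. destruct Rlt_dec; [lra|reflexivity]. }
assert (X_loc : forall t, t < T -> locally t (fun s => x s = X s)).
{ intros t Ht. apply (locally_interval _ t m_infty T); [exact I|exact Ht|].
  intros s _ Hs. symmetry. now apply Xx. }
assert (X_cont : forall t, continuous X t).
{ intros t. destruct (Rtotal_order t T) as [Ht|[->|Ht]].
  - apply (continuous_ext_loc X x t); [now apply X_loc|]. now apply (reg_x_cont _ _ _ _ reg).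
  - apply continuous_of_eps. intros eps He. rewrite (XL T) by lra.
    assert (exists s, 0 <= s < T /\ L - eps < x s) as [s [Hs Hxs]].
    { apply NNPP. intros Hn. cut (L <= L - eps); [lra|]. apply Llub.
      intros v [s [Hs ->]]. apply Rnot_lt_le. intros H. apply Hn. now exists s. }
    exists (T - s). split; [lra|]. intros r Hr. apply Rabs_lt_between in Hr.
    destruct (Rlt_le_dec r T) as [HrT|HrT].
    + rewrite Xx by exact HrT. assert (H1 := xL r ltac:(lra)).
      assert (H2 := x_incr s r ltac:(lra) HrT). apply Rabs_lt_between. lra.
    + rewrite XL by exact HrT. rewrite Rminus_diag, Rabs_R0. exact He.
  - apply (continuous_ext_loc X (fun _ => L) t); [|apply continuous_const].
    apply (locally_interval _ t T p_infty); [exact Ht|exact I|].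
    intros s Hs _. symmetry. apply XL. now apply Rlt_le. }
(* Bounded and continuous on the line. The lower clamp is never active because the continuation is
   nondecreasing past [T]; the margin 1 above [L] keeps the upper one inactive for a while. *)
set (f1 := fun u => f (Rmax (Rmin u (L + 1)) (x 0))).
assert (clamp_in : forall u, x 0 <= Rmax (Rmin u (L + 1)) (x 0) <= L + 1).
{ intros u. unfold Rmax, Rmin. repeat destruct Rle_dec; lra. }
assert (f1f : forall u, x 0 <= u <= L + 1 -> f1 u = f u).
{ intros u Hu. unfold f1. rewrite Rmin_left, Rmax_left by lra. reflexivity. }
assert (f1_cont : forall u, continuous f1 u).
{ intros u. apply (continuous_comp (fun u => Rmax (Rmin u (L + 1)) (x 0)) f).
  - apply (continuous_comp (fun u => Rmin u (L + 1)) (fun v => Rmax v (x 0)));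
      [apply continuous_Rmin_l|apply continuous_Rmax_l].
  - apply (reg_f_cont _ _ _ _ reg). specialize (clamp_in u). lra. }
assert (f1_pos : forall u, 0 < f1 u).
{ intros u. apply (reg_f_pos _ _ _ _ reg). specialize (clamp_in u). lra. }
destruct (continuous_bounded f (x 0) (L + 1)) as [M [HM HfM]].
{ intros u Hu. apply (reg_f_cont _ _ _ _ reg). lra. }
destruct (continuation_step w f1 X T M T_pos) as [y [y_cont [yX y_eq]]].
{ apply (reg_w_cont _ _ _ _ reg). }
{ exact f1_cont. }
{ intros u. apply HfM, clamp_in. }
{ exact X_cont. }
{ intros t Ht. apply (is_derive_ext_loc x); [apply X_loc; lra|].
  replace (conv w (fun s => f1 (X s)) t) with (conv w (fun s => f (x s)) t).
  - apply (reg_x_eq _ _ _ _ reg); [lra|]. simpl. lra.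
  - apply conv_ext; [lra|reflexivity|]. intros s Hs. rewrite Xx by lra.
    symmetry. apply f1f. assert (H1 := xL s ltac:(lra)).
    assert (H2 := x_incr 0 s ltac:(lra) ltac:(lra)). lra. }
assert (y_ge : forall t, 0 <= t < T + 1 -> x 0 <= y t).
{ intros t Ht. destruct (Rlt_le_dec t T) as [HtT|HtT].
  - rewrite yX, Xx by lra. apply x_incr; lra.
  - apply Rle_trans with (y T).
    + rewrite yX, XL by lra. exact x0L.
    + apply le_of_derive_nonneg with (conv w (fun s => f1 (y s))); [exact HtT| | |]; intros s Hs.
      * apply y_cont.
      * apply y_eq. lra.
      * apply RInt_nonneg; [lra| |]; intros r Hr.
        -- apply continuous_conv_integrand; [apply (reg_w_cont _ _ _ _ reg)|].
           now apply (continuous_comp y f1).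
        -- apply Rmult_le_pos; [apply (reg_w_nonneg _ _ _ _ reg)|now apply Rlt_le]. }
(* Until [T + d] the continuation differs from [L] by less than 1, so [f1] may be replaced by
   [f]. *)
destruct (filterlim_locally_elim _ _ _ _ (y_cont T) 1 ltac:(lra)) as [d Hd].
exists y, (Rmin d 1).
assert (Hd1 := Rmin_l d 1). assert (Hd2 := Rmin_r d 1). assert (Hdp := cond_pos d).
split; [apply Rmin_pos; lra|]. split; [exact y_cont|]. split; [|split].
- intros t Ht. rewrite yX, Xx by lra. reflexivity.
- intros t Ht. specialize (y_ge t ltac:(lra)). lra.
- intros t Ht.
  replace (conv w (fun s => f (y s)) t) with (conv w (fun s => f1 (y s)) t); [apply y_eq; lra|].
  apply conv_ext; [lra|reflexivity|]. intros s Hs. apply f1f.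
  split; [apply y_ge; lra|].
  destruct (Rle_lt_dec s T) as [HsT|HsT].
  + rewrite yX by lra. destruct (Rlt_le_dec s T) as [HsT'|HsT'].
    * rewrite Xx by exact HsT'. specialize (xL s ltac:(lra)). lra.
    * rewrite XL by exact HsT'. lra.
  + assert (Hy : Rabs (y s - y T) < 1).
    { apply Hd. change (Rabs (s - T) < d). rewrite Rabs_pos_eq; lra. }
    rewrite (yX T), XL in Hy by lra. apply Rabs_lt_between in Hy. lra.
Qed.

End BoundedSolution.

(** * Extension to negative times and conclusion *)

Lemma continuous_extend_left (h : R -> R) (t : R) :
  filterlim h (at_right 0) (locally (h 0)) -> (0 < t -> continuous h t) ->
  continuous (fun s => h (Rmax s 0)) t.
Proof.
intros H0 Ht. destruct (Rlt_le_dec 0 t) as [Hp|Hn].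
- apply (continuous_comp (fun s => Rmax s 0) h); [apply continuous_Rmax_l|].
  rewrite Rmax_left by lra. now apply Ht.
- apply continuous_of_eps. intros eps He.
  destruct (filterlim_locally_elim (at_right 0) h (h 0) _ H0 eps He) as [d Hd].
  exists d. split; [apply cond_pos|]. intros s Hs.
  rewrite (Rmax_right t) by exact Hn. apply Rabs_lt_between in Hs.
  destruct (Rlt_le_dec 0 s) as [Hs0|Hs0].
  + rewrite Rmax_left by lra. apply Hd; [|exact Hs0].
    change (Rabs (s - 0) < d). rewrite Rminus_0_r, Rabs_pos_eq; lra.
  + rewrite Rmax_right by exact Hs0. rewrite Rminus_diag, Rabs_R0. exact He.
Qed.

Lemma conv_extend_left (w g : R -> R) (t : R) :
  0 <= t ->
  conv (fun u => w (Rmax u 0)) (fun s => g (Rmax s 0)) t = RInt (fun s => w (t - s) * g s) 0 t.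
Proof.
intros Ht. apply RInt_ext. intros s. rewrite Rmin_left, Rmax_right by exact Ht.
intros Hs. rewrite !Rmax_left by lra. reflexivity.
Qed.

Lemma regular_of_is_solution (w f x : R -> R) (S : Rbar) :
  (forall u, 0 < u -> continuous f u /\ 0 < f u) ->
  (forall t, 0 < t -> continuous w t) ->
  filterlim w (at_right 0) (locally (w 0)) ->
  (forall t, 0 <= t -> 0 <= w t) ->
  is_solution w f x S ->
  regular_solution (fun u => w (Rmax u 0)) f (fun t => x (Rmax t 0)) S.
Proof.
intros Hf Hw Hw0 Hwp [HS [_ [xpos [x0 xeq]]]]. constructor.
- intros u. apply continuous_extend_left; [exact Hw0|apply Hw].
- intros u. apply Hwp, Rmax_r.
- intros u Hu. now apply Hf.
- intros u Hu. now apply Hf.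
- intros t Ht. apply continuous_extend_left; [exact x0|]. intros Hp.
  eapply is_derive_continuous. now apply xeq.
- intros t Ht. apply xpos; [apply Rmax_r|]. unfold Rmax. now destruct Rle_dec.
- intros t Hp Ht. rewrite (conv_extend_left w (fun s => f (x s))) by lra.
  apply (is_derive_ext_loc x); [|now apply xeq].
  apply (locally_interval _ t 0 p_infty); [exact Hp|exact I|].
  intros s Hs _. rewrite Rmax_left; [reflexivity|]. simpl in Hs. lra.
Qed.

Theorem theorem3p1 (f w : R -> R) :
  (forall x, 0 < x -> continuous f x /\ 0 < f x) ->
  asymp_increasing f ->
  filterlim (fun x => f x / x) (Rbar_locally p_infty) (Rbar_locally p_infty) ->
  (forall t, 0 < t -> continuous w t) ->
  filterlim w (at_right 0) (locally (w 0)) ->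
  (forall t, 0 <= t -> 0 <= w t) ->
  0 < w 0 ->
  (forall u, 0 < u -> ex_RInt_gen f (at_right 0) (at_point u)) ->
  (exists eta, 0 < eta /\
     ex_RInt_gen (fun u => / sqrt (prim f u)) (at_point eta) (Rbar_locally p_infty)) ->
  preserves_superexp f ->
  forall (x : R -> R) (S : Rbar),
    is_maximal_solution w f x S ->
    exists T : R, S = Finite T /\ 0 < T /\
      filterlim x (at_left T) (Rbar_locally p_infty) /\
      filterlim (fun t => F_B f (x t) / (T - t)) (at_left T)
        (locally (sqrt (2 * w 0))).
Proof.
intros Hf Hasymp Hsuper Hw Hw0 Hwp w0_pos Hint [eta [Heta HFB]] Hpres x S [Hsol Hmax].
assert (reg := regular_of_is_solution w f x S Hf Hw Hw0 Hwp Hsol).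
destruct Hsol as [HS [x0 [xpos [xc xeq]]]].
set (w1 := fun u => w (Rmax u 0)) in *.
set (x1 := fun t => x (Rmax t 0)) in *.
assert (w10 : w1 0 = w 0) by (unfold w1; rewrite Rmax_left by lra; reflexivity).
assert (x1x : forall t, 0 <= t -> x1 t = x t).
{ intros t Ht. unfold x1. rewrite Rmax_left by exact Ht. reflexivity. }
destruct S as [T| |].
- exists T. split; [reflexivity|]. split; [exact HS|]. simpl in HS.
  assert (blowup : filterlim x1 (at_left T) (Rbar_locally p_infty)).
  { intros P [K HK].
    (* Exceeding [K] once is enough, as [x1] is nondecreasing. Were [K] a bound, the solution would
       extend to [T + d], against maximality. *)
    assert (exists a, 0 <= a < T /\ K < x1 a) as [a [Ha Hxa]].
    { apply NNPP. intros Hn.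
      destruct (bounded_solution_extends w1 f x1 T reg HS K) as [y [d [Hd [yc [yx [ypos yeq]]]]]].
      { intros t Ht. apply Rnot_lt_le. intros H. apply Hn. now exists t. }
      assert (E : Finite (T + d) = Finite T).
      { apply (Hmax y).
        - split; [simpl; lra|]. split; [apply ypos; lra|]. split; [|split].
          + intros t Ht HtS. apply ypos. now split.
          + apply (filterlim_filter_le_1 (F := locally 0) (G := at_right 0)); [|apply yc].
            intros Q [e He]. exists e. intros s Hs _. now apply He.
          + intros t Ht HtS. assert (Hy := yeq t (conj Ht HtS)).
            replace (RInt (fun s => w (t - s) * f (y s)) 0 t) with (conv w1 (fun s => f (y s)) t);
              [exact Hy|].
            apply conv_ext; [lra| |reflexivity]. intros s Hs.
            unfold w1. rewrite Rmax_left by lra. reflexivity.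
        - simpl. lra.
        - intros t Ht HtT. rewrite yx by (now split). now apply x1x. }
      injection E. lra. }
    apply at_left_intro with a; [apply Ha|]. intros t Ht. apply HK.
    apply Rlt_le_trans with (x1 a); [exact Hxa|].
    apply (sol_increasing _ _ _ _ reg); simpl; lra. }
  split.
  + eapply filterlim_ext_loc; [|exact blowup].
    apply at_left_intro with 0; [exact HS|]. intros t Ht. apply x1x. lra.
  + rewrite <- w10. eapply filterlim_ext_loc; [|apply (blowup_rate w1 f x1 T eta); try assumption; lra].
    apply at_left_intro with 0; [exact HS|]. intros t Ht. cbv beta. rewrite x1x by lra. reflexivity.
- exfalso.
  assert (Hw1 : forall u, continuous w1 u) by apply (reg_w_cont _ _ _ _ reg).
  (* Near 0 the kernel stays above [w 0 / 2], which serves as the constant [c]; halving [d] provides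
     the strict inequality at the right end of the lag interval. *)
  destruct (uniformly_continuous w1 0 1 (w 0 / 2)) as [d [Hd Hu]]; [now intros|lra|].
  assert (Hm1 := Rmin_l (d / 2) 1). assert (Hm2 := Rmin_r (d / 2) 1).
  apply (no_global_solution w1 f x1 eta (w 0 / 2) (Rmin (d / 2) 1) reg); try assumption.
  + lra.
  + apply Rmin_pos; lra.
  + intros u Hu'. specialize (Hu 0 u ltac:(lra) ltac:(lra)). rewrite Rminus_0_r in Hu.
    rewrite Rabs_pos_eq in Hu by lra. specialize (Hu ltac:(lra)).
    rewrite w10 in Hu. apply Rabs_lt_between in Hu. lra.
- destruct HS.
Qed.
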